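(* Let $P$ be the transition kernel of a $\pi$-irreducible Markov chain that is reversible with respect to its invariant probability measure $\pi$. Assume that there exist an accessible atom $A$ and a constant $\kappa>1$ such that $\sup_{x\in A}\mathbb{E}_x[\kappa^{\tau_A}]<\infty$. Let $$\rho=\sup\Bigl\{s\le\kappa:\ \sup_{x\in A}\sum_{n=1}^{\infty}s^{2n}F^{2n}(x,A)<1\Bigr\}.$$ Then $r_0(P)\le\rho^{-1}$. Moreover (for all $n$), $$\sup_{x\in A}\|P^n(x,\cdot)-\pi\|_{\mathrm{Var}}\le\bigl(\pi(A)^{-1}-1\bigr)^{1/2}\rho^{-n},$$ and for $\pi$-a.s. $x\in X$ there exists a constant $C(x)<\infty$ such that $$\|P^n(x,\cdot)-\pi\|_{\mathrm{Var}}\le C(x)\rho^{-n}.$$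
   Context: $\Phi=\{\Phi_n:n\in\mathbb{Z}_+\}$ is a discrete-time homogeneous Markov chain on a general state space $X$ with countably generated $\sigma$-field $\mathscr{B}(X)$ and $n$-step transition kernel $P^n(x,B)=\mathbb{P}_x\{\Phi_n\in B\}$; $\mathbb{P}_x,\mathbb{E}_x$ are probability and expectation given $\Phi_0=x$. The chain has a (unique) invariant probability measure $\pi$ and is $\pi$-irreducible: if $\pi(B)>0$, there exists $n\in\mathbb{N}$ such that $P^n(x,B)>0$ for all $x\in X$. It is assumed that $P^n(x,\cdot)\ll\pi$ ($n\ge1$), with density $p^n(x,y)$. Reversible: $\pi(dx)P(x,dy)=\pi(dy)P(y,dx)$. A set $A\in\mathscr{B}(X)$ is an atom if there is a probability measure $\nu$ on $\mathscr{B}(X)$ with $P(x,B)=\nu(B)$ for all $x\in A$, $B\in\mathscr{B}(X)$; it is an accessible atom if moreover $\pi(A)>0$. $\tau_A=\inf\{n\ge1:\Phi_n\in A\}$, $F^n(x,A)=\mathbb{P}_x\{\tau_A=n\}$. $r_0(P)$ is the spectral radius of $P$ on the Hilbert space $\mathbb{H}=\{f\in L^2(\pi,X):\pi(f)=0\}$. $\|\mu\|_{\mathrm{Var}}=\sup_{|f|\le1}|\mu(f)|$ for a signed measure $\mu$. In the definition of $\rho$, $s$ ranges over non-negative reals.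
   Formalization: The bound on the supremum over x in A is stated for all n ≥ 1 rather than all n; at n = 0 it fails, e.g. for an i.i.d. chain on two points with A = X, where the right side is 0 and the left side is positive. *)

(* Defs.v *)
From HB Require Import structures.
From mathcomp Require Export all_boot all_order all_algebra.
From mathcomp Require Export all_classical all_reals all_analysis.
From mathcomp Require Export complex.

Set Implicit Arguments.
Unset Strict Implicit.
Unset Printing Implicit Defensive.

Export Order.TTheory GRing.Theory Num.Theory.
Export numFieldNormedType.Exports.

Global Open Scope classical_set_scope.
Global Open Scope ring_scope.

Definition countably_generated d (X : measurableType d) : Prop :=
  exists2 G : set (set X), countable G & @measurable d X = <<s G >>.

Section chain.
Context d d' (X : measurableType d) (Omega : measurableType d') (R : realType).
Local Open Scope ereal_scope.
Implicit Types (P : R.-pker X ~> X) (Pr : X -> probability Omega R).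
Implicit Types (Phi : nat -> {mfun Omega >-> X}) (pi : probability X R).
Implicit Types (A B : set X).

(* The sigma-algebra generated by Phi_0, ..., Phi_n. *)
Definition natural_filtration Phi (n : nat) : set (set Omega) :=
  <<s [set C | exists i B, [/\ (i <= n)%N, measurable B & C = Phi i @^-1` B]] >>.

(* [Pr x] is the law of the process started at x. Singletons of X need not be
   measurable, so "Phi_0 = x" is expressed by saying that Phi_0 has law \d_x.
   The last clause is P_x(Phi_(n+1) \in B | Phi_0, ..., Phi_n) = P(Phi_n, B). *)
Definition markov_chain P Pr Phi : Prop :=
  (forall x B, measurable B -> Pr x (Phi 0%N @^-1` B) = \d_x B) /\
  (forall x n C B, natural_filtration Phi n C -> measurable B ->
    Pr x (C `&` Phi n.+1 @^-1` B) = \int[Pr x]_(w in C) P (Phi n w) B).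

(* The n-step transition kernel P^n(x, B) = P_x(Phi_n \in B). *)
Definition nstep Pr Phi (n : nat) (x : X) : probability X R :=
  distribution (Pr x) (Phi n).

Definition invariant P pi : Prop :=
  forall B, measurable B -> \int[pi]_x P x B = pi B.

(* pi(dx) P(x, dy) = pi(dy) P(y, dx), as measures on X * X. *)
Definition reversible P pi : Prop :=
  forall E : set (X * X), measurable E ->
    \int[pi]_x P x (xsection E x) = \int[pi]_y P y (ysection E y).

Definition irreducible Pr Phi pi : Prop :=
  forall B, measurable B -> 0 < pi B ->
    forall x, exists2 n : nat, (1 <= n)%N & 0 < nstep Pr Phi n x B.

Definition atom P A : Prop :=
  measurable A /\
  exists nu : probability X R,
    forall x, A x -> forall B, measurable B -> P x B = nu B.

Definition accessible_atom P pi A : Prop := atom P A /\ 0 < pi A.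

(* The infimum is taken in \bar R, so that tau_A = +oo if A is never hit. *)
Definition tau Phi A (w : Omega) : \bar R :=
  ereal_inf [set n%:R%:E | n in [set n : nat | (1 <= n)%N /\ A (Phi n w)]].

Definition first_return Pr Phi (n : nat) (x : X) A : \bar R :=
  Pr x [set w | tau Phi A w = n%:R%:E].

(* k ^ t for k > 1 and t extended: k ^ +oo = +oo and k ^ -oo = 0. *)
Definition exp_base (k : R) (t : \bar R) : \bar R :=
  match t with r%:E => (k `^ r)%:E | +oo => +oo | -oo => 0 end.

Definition rho_set Pr Phi A (kappa : R) : set R :=
  [set s | [/\ (0 <= s)%R, (s <= kappa)%R &
    ereal_sup [set \sum_(1 <= n <oo)
                 ((s ^+ (2 * n))%:E * first_return Pr Phi (2 * n) x A) | x in A] < 1]].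

(* [rho_set] contains 0 and is bounded by kappa, so the real sup is genuine. *)
Definition rho Pr Phi A (kappa : R) : R := sup (rho_set Pr Phi A kappa).

(* The norm of the signed measure mu - nu. *)
Definition var_dist (mu nu : probability X R) : \bar R :=
  ereal_sup [set (`| \int[mu]_x f x - \int[nu]_x f x |%R)%:E |
    f in [set f : X -> R |
      measurable_fun setT f /\ forall x, (`|f x| <= 1)%R]].

End chain.

Section spectrum.
Context d (X : measurableType d) (R : realType).
Implicit Types (pi : probability X R) (P : R.-pker X ~> X) (f g : X -> R[i]).
Local Notation normc := ComplexField.Normc.normc.

Definition cintegral (mu : {measure set X -> \bar R}) f : R[i] :=
  Complex (\int[mu]_x complex.Re (f x)) (\int[mu]_x complex.Im (f x)).

(* Complex L^2(pi), on representatives: equality of elements is equality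
   pi-almost everywhere. *)
Definition L2 pi f : Prop :=
  ((fun x => complex.Re (f x)) \in Lfun pi 2%:E) /\
  ((fun x => complex.Im (f x)) \in Lfun pi 2%:E).

Definition L2norm pi f : \bar R := Lnorm pi 2%:E (fun x => (normc (f x))%:E).

Definition HH pi f : Prop := L2 pi f /\ cintegral pi f = 0.

Definition kernel_op P f : X -> R[i] := fun x => cintegral (P x) f.

(* P - z, acting on functions. *)
Definition shifted_op P (z : R[i]) f : X -> R[i] :=
  fun x => kernel_op P f x - z * f x.

(* P - z is a bijection of HH onto itself with bounded inverse. *)
Definition resolvent_set P pi : set R[i] :=
  [set z | [/\
    forall g, HH pi g ->
      exists2 f, HH pi f & {ae pi, forall x, shifted_op P z f x = g x},
    forall f, HH pi f ->
      {ae pi, forall x, shifted_op P z f x = 0} -> {ae pi, forall x, f x = 0} &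
    exists M : R, forall f, HH pi f ->
      (L2norm pi f <= M%:E * L2norm pi (shifted_op P z f))%E]].

Definition spectrum P pi : set R[i] := ~` resolvent_set P pi.

(* The element 0 only matters if HH is the zero space and the spectrum empty. *)
Definition spectral_radius P pi : \bar R :=
  ereal_sup (0%E |` [set (normc z)%:E | z in spectrum P pi]).

End spectrum.

(* Main.v *)
(* On the functions of mean zero in L^2(pi), P is self-adjoint, so that its spectral
   radius is its norm, and its norm is at most 1/rho once P - c is bounded below for
   all real c with 1/rho < |c| <= 1. Let Q be P restricted to the complement of the
   atom A. By reversibility, Kac's formula and the log-convexity of |Q^n f|^2, the
   exponential moment of tau_A gives |Q| <= 1/kappa. Hence solving (P - c) f = e off
   A is harmless, and what remains is one scalar equation on A, with coefficient
   c (F(1/c) - 1), where F is the generating function of the return times to A. For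
   c = 1 it is replaced by the mean-zero condition; for 0 < c < 1, F(1/c) > 1; for
   c < 0, the odd times contribute negatively to F(1/c), so that F(1/c) < 1 as long as
   the even times alone contribute less than 1, which is the definition of rho.
   The norm bound gives the convergence from A at once, since by reversibility
   P^n(x,.) for x in A has the L^2 density P^n (1_A / pi A), and the convergence from
   almost every x follows by decomposing at the first entrance into A. *)
From HB Require Import structures.
Require Import Defs.
From mathcomp Require Import measurable_realfun ring lra.
Set Implicit Arguments.
Unset Strict Implicit.
Unset Printing Implicit Defensive.

(** * Semi-inner product spaces *)

(** The norm bound is proved without completeness and without the spectral theorem. It is proved
    first for bounded measurable functions, taken as functions and not as classes modulo [pi], so
    that [P] acts at every point and identities hold pointwise; the price is an inner product that
    is only semidefinite. On this space limits need not exist, so the Neumann series of [Q] off the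
    atom is truncated, and its remainder has to be absorbed. Only real [c] have to be tested, by
    expanding [|(T - L)(T + L) f|^2], and only [|c| <= 1], because [P] is a contraction. The
    condition [rho <= kappa] keeps these [c] above [1 / kappa], where [c - Q] is bounded below. The
    spectrum, however, is defined on complex [L^2]. Truncation, centring and Fatou's lemma carry the
    bound over; real and imaginary parts are treated separately without loss in the constant, which
    matters since the constant is the bound on the radius. Completeness enters only there, through
    series whose norms decay geometrically. *)

Record semi_inner_product (R : realType) (V : lmodType R) (ip : V -> V -> R) :
    Prop := SemiInnerProduct {
  sipC : forall f g, ip f g = ip g f;
  sipDl : forall f g h, ip (f + g) h = ip f h + ip g h;
  sipZl : forall c f h, ip (c *: f) h = c * ip f h;
  sip_ge0 : forall f, 0 <= ip f f }.

Definition sip_norm (R : realType) (V : lmodType R) (ip : V -> V -> R) f : R :=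
  Num.sqrt (ip f f).

Section semi_inner_product_theory.
Context (R : realType) (V : lmodType R) (ip : V -> V -> R).
Hypothesis ipP : semi_inner_product ip.
Local Notation "`[ f ]" := (sip_norm ip f) (at level 0, format "`[ f ]").
Implicit Types (f g h : V) (c : R).

Let ipC := sipC ipP.
Let ipDl := sipDl ipP.
Let ipZl := sipZl ipP.
Let ip_ge0 := sip_ge0 ipP.

Lemma sipDr f g h : ip h (f + g) = ip h f + ip h g.
Proof. by rewrite ipC ipDl !(ipC h). Qed.

Lemma sipZr c f h : ip h (c *: f) = c * ip h f.
Proof. by rewrite ipC ipZl ipC. Qed.

Lemma sipNl f h : ip (- f) h = - ip f h.
Proof. by rewrite -scaleN1r ipZl mulN1r. Qed.

Lemma sipNr f h : ip h (- f) = - ip h f.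
Proof. by rewrite ipC sipNl ipC. Qed.

Lemma sipBl f g h : ip (f - g) h = ip f h - ip g h.
Proof. by rewrite ipDl sipNl. Qed.

Lemma sipBr f g h : ip h (f - g) = ip h f - ip h g.
Proof. by rewrite sipDr sipNr. Qed.

Lemma sip_norm_ge0 f : 0 <= `[f].
Proof. exact: sqrtr_ge0. Qed.

Lemma sqr_sip_norm f : `[f] ^+ 2 = ip f f.
Proof. by rewrite sqr_sqrtr. Qed.

Lemma sip_sqr_le f g : ip f g ^+ 2 <= ip f f * ip g g.
Proof.
have key t : 0 <= ip f f + 2 * t * ip f g + t ^+ 2 * ip g g.
  have := ip_ge0 (f + t *: g).
  by rewrite ipDl !sipDr !ipZl !sipZr (ipC g f); lra.
have := ip_ge0 f; have := ip_ge0 g.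
have [g0|gn0] := eqVneq (ip g g) 0; last first.
  move=> gg ff; have gp : 0 < ip g g by rewrite lt0r gn0.
  have := key (- ip f g / ip g g).
  have -> : ip f f + 2 * (- ip f g / ip g g) * ip f g +
    (- ip f g / ip g g) ^+ 2 * ip g g = (ip f f * ip g g - ip f g ^+ 2) / ip g g.
    by field.
  by rewrite pmulr_lge0 ?invr_gt0// subr_ge0.
move=> _ ff; rewrite g0 mulr0.
have [->|n0] := eqVneq (ip f g) 0; first by rewrite expr0n.
(* With [ip g g = 0] the quadratic in [t] is affine; this [t] gives it the value [-1]. *)
have := key (- (ip f f + 1) / (2 * ip f g)).
have -> : ip f f + 2 * (- (ip f f + 1) / (2 * ip f g)) * ip f g +
  (- (ip f f + 1) / (2 * ip f g)) ^+ 2 * ip g g = -1.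
  by rewrite g0; field.
by rewrite ler0N1.
Qed.

Lemma sip_le_norm f g : `|ip f g| <= `[f] * `[g].
Proof.
rewrite -(@ler_pXn2r _ 2)// ?nnegrE ?mulr_ge0 ?sip_norm_ge0//.
by rewrite exprMn !sqr_sip_norm real_normK ?num_real// sip_sqr_le.
Qed.

Lemma sip_normZ c f : `[c *: f] = `|c| * `[f].
Proof.
by rewrite /sip_norm ipZl sipZr mulrA -expr2 sqrtrM ?sqr_ge0// sqrtr_sqr.
Qed.

Lemma sip_normN f : `[- f] = `[f].
Proof. by rewrite -scaleN1r sip_normZ normrN1 mul1r. Qed.

Lemma sip_normD f g : `[f + g] <= `[f] + `[g].
Proof.
rewrite -(@ler_pXn2r _ 2)// ?nnegrE ?addr_ge0 ?sip_norm_ge0//.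
rewrite sqrrD !sqr_sip_norm ipDl !sipDr (ipC g f).
have := le_trans (ler_norm _) (sip_le_norm f g); lra.
Qed.

Lemma sip_normB f g : `[f - g] <= `[f] + `[g].
Proof. by rewrite (le_trans (sip_normD _ _))// sip_normN. Qed.

(* [n |-> |T^n f|^2] is log-convex, so its initial ratio is at most its
   exponential growth rate. *)
Lemma selfadjoint_le_growth (T : V -> V) (C c : R) f :
  (forall g h, ip (T g) h = ip g (T h)) -> 0 < c ->
  (forall n, ip (iter n T f) (iter n T f) <= C * c ^+ n) ->
  ip (T f) (T f) <= c * ip f f.
Proof.
move=> Tsa c0 Tgrow; pose b n := ip (iter n T f) (iter n T f).
have b_ge0 n : 0 <= b n by exact: ip_ge0.
have b_logcvx n : b n.+1 ^+ 2 <= b n * b n.+2.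
  by have := sip_sqr_le (iter n T f) (iter n.+2 T f); rewrite {1}iterS -Tsa.
rewrite leNgt; apply/negP => lt_b.
have b1 : c * b 0 < b 1 by exact: lt_b.
have b0 : 0 < b 0.
  rewrite lt0r b_ge0 andbT; apply/eqP => b00.
  have := b_logcvx 0; rewrite b00 mul0r => b10.
  have {}b10 : b 1 = 0 by apply/eqP; rewrite -sqrf_eq0 eq_le b10 sqr_ge0.
  by move: b1; rewrite b00 b10 mulr0 ltxx.
(* By log-convexity the ratios [b n.+1 / b n] never fall below the first one, [q > c], so [b]
   outgrows [C * c ^ n]. *)
pose q := b 1 / b 0.
have cq : c < q by rewrite ltr_pdivlMr.
have q0 : 0 < q by exact: lt_trans cq.
have ratio n : 0 < b n /\ q * b n <= b n.+1.
  elim: n => [|n [bn0 IHn]]; first by rewrite /q divfK ?gt_eqF.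
  have bn1 : 0 < b n.+1 by rewrite (lt_le_trans _ IHn)// mulr_gt0.
  split=> //; rewrite -(ler_pM2l bn0) (le_trans _ (b_logcvx n))//.
  by rewrite mulrCA mulrA expr2 ler_wpM2r// ltW.
have qn n : q ^+ n * b 0 <= b n.
  elim: n => [|n IHn]; first by rewrite mul1r.
  rewrite exprS -mulrA (le_trans _ (ratio n).2)// ler_wpM2l// ltW//.
have bnd n : (q / c) ^+ n <= C / b 0.
  rewrite ler_pdivlMr// expr_div_n mulrAC ler_pdivrMr ?exprn_gt0//.
  exact: le_trans (qn n) (Tgrow n).
have qc : 1 < q / c by rewrite ltr_pdivlMr// mul1r.
have [n] : exists n, C / b 0 < (q / c) ^+ n.
  have [n Cn] : exists n : nat, C / b 0 / (q / c - 1) < n%:R.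
    by exists (Num.truncn `|C / b 0 / (q / c - 1)|).+1;
       rewrite (le_lt_trans (ler_norm _))// truncnS_gt.
  (* Bernoulli's inequality in the form [n * (x - 1) <= x ^ n]. *)
  exists n; move: Cn; rewrite ltr_pdivrMr ?subr_gt0// => /lt_le_trans; apply.
  rewrite mulrC.
  elim: n => [|n IHn]; first by rewrite mulr0.
  rewrite -natr1 mulrDr mulr1 exprS.
  set x := q / c in qc IHn *; have xn : 1 <= x ^+ n by rewrite exprn_ege1// ltW.
  nra.
by rewrite ltNge bnd.
Qed.

(* For self-adjoint [T] with norm [L] on [D], [T - L] or [T + L] is not bounded
   below on [D]. *)
Lemma selfadjoint_le_bounded_below (T : V -> V) (D : set V) (l : R) :
  (forall g h, ip (T g) h = ip g (T h)) ->
  (forall c g, D g -> D (T g + c *: g)) -> 0 <= l ->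
  (forall f, D f -> `[T f] <= `[f]) ->
  (forall c, l < `|c| -> `|c| <= 1 -> exists2 K : R, 0 < K &
    forall f, D f -> `[f] <= K * `[T f - c *: f]) ->
  forall f, D f -> `[T f] <= l * `[f].
Proof.
move=> Tsa TD l0 Tcontr Tbelow.
pose S : set R := [set c | 0 <= c /\ forall f, D f -> `[T f] <= c * `[f]].
have S1 : S 1 by split=> // f Df; rewrite mul1r Tcontr.
have Slb : has_lbound S by exists 0 => c [].
have Sinf : has_inf S by split=> //; exists 1.
have SL : S (inf S).
  split=> [|f Df]; first by apply: lb_le_inf => [|c []//]; exists 1.
  rewrite leNgt; apply/negP => Lf.
  have f0 : 0 < `[f].
    rewrite lt0r sip_norm_ge0 andbT; apply/eqP => f0.
    by move: (Tcontr _ Df) Lf; rewrite f0 mulr0 => /le_lt_trans /[apply]; rewrite ltxx.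
  have : inf S < `[T f] / `[f] by rewrite ltr_pdivlMr.
  move=> /(inf_lt Sinf.1)[c [c0 Sc]]; rewrite ltr_pdivlMr// => /lt_le_trans.
  by move=> /(_ _ (Sc _ Df)); rewrite ltxx.
set L := inf S in SL.
suff Ll : L <= l.
  by move=> f Df; rewrite (le_trans (SL.2 f Df))// ler_wpM2r ?sip_norm_ge0.
rewrite leNgt; apply/negP => lL.
have L0 : 0 < L by exact: le_lt_trans lL.
have L1 : L <= 1 by exact: ge_inf.
have aL : `|L| = L by rewrite gtr0_norm.
have [K K0 bK] : exists2 K : R, 0 < K & forall f, D f -> `[f] <= K * `[T f - L *: f].
  by apply: Tbelow; rewrite aL.
have [K' K'0 bK'] :
    exists2 K : R, 0 < K & forall f, D f -> `[f] <= K * `[T f - (- L) *: f].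
  by apply: Tbelow; rewrite normrN aL.
pose e := (K * K')^-1.
have e0 : 0 < e by rewrite invr_gt0 mulr_gt0.
(* The two lower bounds combine to one for [h = T^2 f - L^2 f]. Expanding [|h|^2] and using
   [|T^2 f| <= L * |T f|] leaves a gap in [|T f| <= L * |f|] that is controlled by [e]. *)
have step f : D f -> e ^+ 2 * ip f f <= L ^+ 2 * (L ^+ 2 * ip f f - ip (T f) (T f)).
  move=> Df; pose g := T f + (- L) *: f.
  have Dg : D g by exact: TD.
  have fg : `[f] <= K * `[g] by rewrite /g scaleNr; exact: bK.
  have gh := bK' g Dg; set h := T g - _ in gh.
  have fh : e * `[f] <= `[h].
    rewrite mulrC ler_pdivrMr ?mulr_gt0// mulrC (le_trans fg)// -mulrA ler_wpM2l//.
    exact: ltW.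
  have : (e * `[f]) ^+ 2 <= `[h] ^+ 2.
    by rewrite ler_pXn2r// nnegrE ?mulr_ge0 ?sip_norm_ge0// ltW.
  rewrite exprMn !sqr_sip_norm => /le_trans; apply.
  have Tg k : ip (T g) k = ip (T (T f)) k - L * ip (T f) k.
    by rewrite Tsa /g ipDl ipZl -!Tsa mulNr.
  have kTg k : ip k (T g) = ip k (T (T f)) - L * ip k (T f).
    by rewrite !(ipC k) Tg.
  have -> : ip h h = ip (T (T f)) (T (T f)) - 2 * L ^+ 2 * ip (T f) (T f)
      + L ^+ 4 * ip f f.
    rewrite /h scaleNr opprK /g !(ipDl, sipDr, Tg, kTg, ipZl, sipZr).
    rewrite -(Tsa f (T f)) -(Tsa f f) (Tsa (T f) f).
    ring.
  have : ip (T (T f)) (T (T f)) <= L ^+ 2 * ip (T f) (T f).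
    have DTf : D (T f) by have := TD 0 _ Df; rewrite scale0r addr0.
    have := SL.2 _ DTf.
    rewrite -(@ler_pXn2r _ 2)// ?nnegrE ?mulr_ge0 ?sip_norm_ge0// ?(ltW L0)//.
    by rewrite exprMn !sqr_sip_norm.
  have := ip_ge0 (T f); lra.
(* Its root is an admissible constant below the infimum [L]; the maximum with [0] ensures that the
   square of the root is [m]. *)
pose m := Num.max 0 (L ^+ 2 - e ^+ 2 / L ^+ 2).
have m0 : 0 <= m by rewrite le_max lexx.
have mL : Num.sqrt m < L.
  rewrite -(@ltr_pXn2r _ 2)// ?nnegrE ?sqrtr_ge0// ?(ltW L0)// sqr_sqrtr//.
  by rewrite gt_max exprn_gt0//= gtrBl divr_gt0// exprn_gt0.
have Sm : S (Num.sqrt m).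
  split=> [|f Df]; first exact: sqrtr_ge0.
  rewrite -(@ler_pXn2r _ 2)// ?nnegrE ?mulr_ge0 ?sip_norm_ge0 ?sqrtr_ge0//.
  rewrite exprMn !sqr_sip_norm sqr_sqrtr//.
  apply: (@le_trans _ _ ((L ^+ 2 - e ^+ 2 / L ^+ 2) * ip f f)); last first.
    by rewrite ler_wpM2r// le_max lexx orbT.
  have := step _ Df.
  rewrite -ler_pdivrMl ?exprn_gt0// mulrA => sf.
  rewrite mulrBl (mulrC (e ^+ 2)); lra.
by move: (ge_inf Slb Sm); rewrite leNgt mL.
Qed.

End semi_inner_product_theory.

(** * The resolvent of a self-adjoint operator with an atom *)

(* [pa] and [pb] stand for the multiplications by the indicators of the atom and of
   its complement, [eA] for the indicator of the atom, and [nu f] for the constant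
   value of [P f] on it. *)
Section atom_resolvent.
Context (R : realType) (V : lmodType R) (ip : V -> V -> R).
Hypothesis ipP : semi_inner_product ip.
Local Notation "`[ f ]" := (sip_norm ip f) (at level 0, format "`[ f ]").
Context (P Q pa pb : {linear V -> V}) (nu : V -> R) (eA : V) (k : R).
Hypothesis pbE : forall f, pb f = f - pa f.
Hypothesis QE : forall f, Q f = pb (P (pb f)).
Hypothesis P_sa : forall f g, ip (P f) g = ip f (P g).
Hypothesis P_contr : forall f, `[P f] <= `[f].
Hypothesis pa_sa : forall f g, ip (pa f) g = ip f (pa g).
Hypothesis pa_idem : forall f, pa (pa f) = pa f.
Hypothesis pa_eA : pa eA = eA.
Hypothesis paP : forall f, pa (P f) = nu f *: eA.
Hypothesis eA_gt0 : 0 < ip eA eA.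
Hypothesis k_gt0 : 0 < k.
Hypothesis Q_le : forall f, `[Q f] <= k * `[f].

Let nrm0 := sip_norm_ge0 ip.

Let pa_contr f : `[pa f] <= `[f].
Proof.
have : `[pa f] ^+ 2 <= `[f] * `[pa f].
  by rewrite sqr_sip_norm// pa_sa pa_idem (le_trans (ler_norm _))// sip_le_norm.
have := nrm0 (pa f); rewrite le_eqVlt => /orP[/eqP <- //|pf0].
by rewrite expr2 ler_pM2r.
Qed.

Let pb_contr f : `[pb f] <= `[f].
Proof.
have pa_pb : pa (pb f) = 0 by rewrite pbE linearB/= pa_idem subrr.
have : `[pb f] ^+ 2 <= `[f] * `[pb f].
  rewrite sqr_sip_norm// {1}pbE sipBl// pa_sa pa_pb.
  rewrite -(scale0r 0) sipZr// mul0r subr0.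
  by rewrite (le_trans (ler_norm _))// sip_le_norm.
have := nrm0 (pb f); rewrite le_eqVlt => /orP[/eqP <- //|pf0].
by rewrite expr2 ler_pM2r.
Qed.

Let pb_idem f : pb (pb f) = pb f.
Proof. by rewrite [LHS]pbE [X in pa X]pbE linearB/= pa_idem subrr subr0. Qed.

Let pa_pb f : f = pa f + pb f.
Proof. by rewrite pbE addrC subrK. Qed.

Let norm_eA : `[eA] * `[eA] = ip eA eA.
Proof. by rewrite -expr2 sqr_sip_norm. Qed.

(** On the atom [P f] is an unknown constant, which drops out once the mean over the atom is
    subtracted. What is left is [e / l] and its own mean, hence the factor [2]. *)
Let atom_part l f : l != 0 ->
  `[pa f - (ip f eA / ip eA eA) *: eA] <= 2 / `|l| * `[P f - l *: f].
Proof.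
move=> l0; set a := ip eA eA; set e := P f - _.
have a0 : a != 0 by rewrite gt_eqF.
have pae : pa e = nu f *: eA - l *: pa f by rewrite /e linearB/= paP linearZ.
have ie : ip e eA = nu f * a - l * ip f eA.
  by rewrite -{1}pa_eA -pa_sa pae sipBl// !(sipZl ipP)// pa_sa pa_eA.
have -> : pa f - (ip f eA / a) *: eA = l^-1 *: ((ip e eA / a) *: eA - pa e).
  rewrite pae ie opprB addrCA -scalerBl scalerDr !scalerA mulVf// scale1r.
  by congr (_ + _); rewrite -scaleNr; congr (_ *: _); field; rewrite l0 a0.
rewrite sip_normZ// normfV mulrC mulrAC ler_wpM2r ?invr_ge0//.
rewrite (le_trans (sip_normB ipP _ _))// mulr_natl mulr2n lerD//.
rewrite sip_normZ// normf_div (gtr0_norm eA_gt0) mulrAC ler_pdivrMr//.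
rewrite (le_trans (ler_wpM2r (nrm0 _) (sip_le_norm ipP _ _)))//.
by rewrite -mulrA norm_eA.
Qed.

(** Off the atom the equation reads [(l - Q) (pb f) = pb (P (pa f)) - pb e], and [l - Q] is bounded
    below by [|l| - k]. *)
Let compl_part l f : k < `|l| ->
  (`|l| - k) * `[pb f] <= `[P f - l *: f] + `[pa f].
Proof.
move=> kl; set e := P f - _.
have -> : (`|l| - k) * `[pb f] = `[l *: pb f] - k * `[pb f].
  by rewrite sip_normZ// mulrBl.
rewrite lerBlDr.
have -> : l *: pb f = pb (P (pa f)) - pb e + Q (pb f).
  have -> : Q (pb f) = pb (P f) - pb (P (pa f)).
    by rewrite QE pb_idem -!linearB/= [X in P (X - _)]pa_pb addrAC subrr add0r.
  by rewrite /e linearB linearZ/= opprB [RHS]addrC addrA subrK addrC subrK.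
rewrite (le_trans (sip_normD ipP _ _))// lerD//.
rewrite (le_trans (sip_normB ipP _ _))// addrC lerD//.
by rewrite (le_trans (pb_contr _)).
Qed.

(** With the value [eA] on the atom, the solution of [(P - l) w = 0] off it would be
    [(l - Q)^-1 (pb (P eA))]. Since [V] need not be complete, the Neumann series is cut after [N]
    terms. *)
Let test_vector l N := eA + \sum_(i < N) l ^- i.+1 *: iter i Q (pb (P eA)).

Let iterQ_pb i f : pb (iter i Q (pb f)) = iter i Q (pb f).
Proof. by case: i => [|i]; rewrite /= ?pb_idem// QE pb_idem. Qed.

Let P_test_vector l N : l != 0 ->
  P (test_vector l N) - l *: test_vector l N =
  (nu (test_vector l N) - l) *: eA + l ^- N *: iter N Q (pb (P eA)).
Proof.
move=> l0; rewrite [P _]pa_pb paP scalerBl -addrA -[RHS]addrA; congr (_ + _).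
suff pbPw : pb (P (test_vector l N)) =
    l *: (test_vector l N - eA) + l ^- N *: iter N Q (pb (P eA)).
  by rewrite pbPw scalerBr addrAC; congr (_ + _); rewrite addrAC subrr add0r.
elim: N => [|N IHN].
  by rewrite /test_vector big_ord0 addr0 subrr scaler0 add0r expr0 invr1 scale1r.
have -> : test_vector l N.+1 =
    test_vector l N + l ^- N.+1 *: iter N Q (pb (P eA)).
  by rewrite /test_vector big_ord_recr/= addrA.
have pbPZ c f g : pb (P (f + c *: g)) = pb (P f) + c *: pb (P g).
  by rewrite !linearD !linearZ.
rewrite pbPZ IHN -[in pb (P (iter _ _ _))]iterQ_pb -QE -iterS.
congr (_ + _); rewrite [in RHS]addrAC [RHS]scalerDr scalerA; congr (_ + _ *: _).
by rewrite exprSr invfM mulrCA mulfV// mulr1.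
Qed.

(* The test vector solves [(P - l) w = 0] off the atom, up to a remainder of order
   [(k / |l|) ^ N]. Pairing [P f - l f] with it therefore controls the mean of [f]
   over the atom as soon as [nu w - l] stays away from [0]; the part of [f] off the
   atom is then controlled by [|Q| <= k < |l|]. *)
Lemma atom_bounded_below (l eta : R) N0 : k < `|l| -> 0 < eta ->
  (forall N, (N0 <= N)%N -> eta <= `|nu (test_vector l N) - l|) ->
  exists2 K : R, 0 < K & forall f, `[f] <= K * `[P f - l *: f].
Proof.
move=> kl eta0 nuw; have l0 : l != 0 by rewrite -normr_gt0 (lt_trans k_gt0).
pose a := ip eA eA; pose al := `|l|; have al0 : 0 < al by rewrite normr_gt0.
have alk : 0 < al - k by rewrite subr_gt0.
pose c1 := 1 + (al - k)^-1; have c10 : 0 < c1 by rewrite addr_gt0 ?invr_gt0.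
pose c2 := c1 * `[eA] / a.
have c20 : 0 <= c2 by rewrite divr_ge0 ?mulr_ge0 ?(ltW c10)// ltW.
have f_le f : `[f] <= (c1 * (2 / al) + (al - k)^-1) * `[P f - l *: f] +
    c2 * `|ip f eA|.
  set e := P f - _.
  have pf : `[pa f] <= 2 / al * `[e] + `|ip f eA| / a * `[eA].
    have := sip_normD ipP (pa f - (ip f eA / ip eA eA) *: eA)
      ((ip f eA / ip eA eA) *: eA).
    rewrite subrK => /le_trans; apply; rewrite lerD ?atom_part//.
    by rewrite sip_normZ// normf_div (gtr0_norm eA_gt0).
  have qf : `[pb f] <= (al - k)^-1 * (`[e] + `[pa f]).
    by rewrite ler_pdivlMl// compl_part.
  rewrite [X in `[X] <= _]pa_pb (le_trans (sip_normD ipP _ _))//.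
  apply: le_trans (lerD (lexx _) qf) _.
  have -> : `[pa f] + (al - k)^-1 * (`[e] + `[pa f]) =
    c1 * `[pa f] + (al - k)^-1 * `[e] by rewrite /c1; ring.
  apply: le_trans (lerD (ler_wpM2l (ltW c10) pf) (lexx _)) _.
  by rewrite /c2 le_eqVlt; apply/orP; left; apply/eqP; ring.
(* For this [N] the remainder contributes at most half of [|f|] and is absorbed on the left; hence
   the factor [2] in the final constant. *)
have [N NN0 thN] : exists2 N, (N0 <= N)%N &
    c2 * ((k / al) ^+ N * `[pb (P eA)]) / eta <= 2^-1.
  have : (fun N => c2 * ((k / al) ^+ N * `[pb (P eA)]) / eta) @ \oo --> 0.
    have -> : 0 = c2 * (0 * `[pb (P eA)]) / eta by rewrite mul0r mulr0 mul0r.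
    apply: cvgMl; apply: cvgMr; apply: cvgMl; apply: cvg_expr.
    by rewrite normf_div normr_id (gtr0_norm k_gt0) ltr_pdivrMr// mul1r.
  move=> /cvgr_le /(_ 2^-1); rewrite invr_gt0 ltr0n => /(_ isT)[n _ thn].
  by exists (maxn N0 n); [exact: leq_maxl|apply: thn; exact: leq_maxr].
pose W := `[test_vector l N].
have m_le f : `|ip f eA| <=
   (W * `[P f - l *: f] + (k / al) ^+ N * `[pb (P eA)] * `[f]) / eta.
  rewrite ler_pdivlMr// (le_trans (ler_wpM2l (normr_ge0 _) (nuw N NN0)))//.
  have : ip (P f - l *: f) (test_vector l N) = (nu (test_vector l N) - l) *
       ip f eA + l ^- N * ip f (iter N Q (pb (P eA))).
    have -> w : ip (P f - l *: f) w = ip f (P w - l *: w).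
      by rewrite sipBl// sipBr// P_sa (sipZl ipP) (sipZr ipP).
    by rewrite P_test_vector// sipDr// !(sipZr ipP).
  move=> E; have -> : `|ip f eA| * `|nu (test_vector l N) - l| =
      `|ip (P f - l *: f) (test_vector l N) -
      l ^- N * ip f (iter N Q (pb (P eA)))|.
    by rewrite E addrK normrM mulrC.
  rewrite (le_trans (ler_normB _ _))// lerD//.
    by rewrite mulrC sip_le_norm.
  have itQ i g : `[iter i Q g] <= k ^+ i * `[g].
    elim: i => [|i IHi]; first by rewrite mul1r.
    by rewrite /= (le_trans (Q_le _))// exprS -mulrA ler_wpM2l// ltW.
  rewrite normrM normfV normrX expr_div_n.
  have -> : k ^+ N / al ^+ N * `[pb (P eA)] * `[f] =
    (al ^+ N)^-1 * (`[f] * (k ^+ N * `[pb (P eA)])) by ring.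
  rewrite ler_wpM2l ?invr_ge0 ?exprn_ge0 ?(ltW al0)//.
  rewrite (le_trans (sip_le_norm ipP _ _))//.
  by rewrite ler_wpM2l ?nrm0.
pose K1 := c1 * (2 / al) + (al - k)^-1.
have K10 : 0 < K1.
  by rewrite addr_gt0 ?mulr_gt0 ?divr_gt0 ?invr_gt0.
exists (2 * (K1 + c2 * W / eta)).
  rewrite mulr_gt0// ltr_pwDl// divr_ge0 ?(ltW eta0)//.
  by rewrite mulr_ge0 ?nrm0.
move=> f; have := f_le f; set e := `[P f - _]; rewrite -/K1.
have := ler_wpM2l c20 (m_le f); rewrite -/e.
have -> : c2 * ((W * e + (k / al) ^+ N * `[pb (P eA)] * `[f]) / eta) =
  c2 * W / eta * e + (c2 * ((k / al) ^+ N * `[pb (P eA)]) / eta) * `[f].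
  by ring.
have := ler_wpM2r (nrm0 f) thN; set th := _ / eta.
set w := c2 * W / eta; nra.
Qed.

(* For [l = 1] the test vector degenerates to [one]: subtract from [f] its mean over
   the atom instead, and use that [f] is orthogonal to [one]. *)
Lemma atom_bounded_below1 one : k < 1 -> P one = one -> pa one = eA ->
  exists2 K : R, 0 < K &
    forall f, ip f one = 0 -> `[f] <= K * `[P f - 1 *: f].
Proof.
move=> k1 P1 pa1; pose c := (1 - k)^-1.
have c0 : 0 < c by rewrite invr_gt0 subr_gt0.
exists (2 + 3 * c); first by rewrite addr_gt0// mulr_gt0.
move=> f f1; pose m := ip f eA / ip eA eA; pose g := f - m *: one.
have Pg : P g - 1 *: g = P f - 1 *: f.
  by rewrite /g !scale1r linearB linearZ/= P1 opprB addrA subrK.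
set e := P f - _ in Pg *.
have pag : `[pa g] <= 2 * `[e].
  have -> : pa g = pa f - m *: eA by rewrite /g linearB linearZ_LR/= pa1.
  by have := atom_part f (oner_neq0 R); rewrite normr1 divr1.
have pbg : `[pb g] <= c * (3 * `[e]).
  rewrite ler_pdivlMl ?subr_gt0//.
  have := @compl_part 1 g; rewrite normr1 Pg => /(_ k1) /le_trans; apply.
  lra.
have gle : `[g] <= (2 + 3 * c) * `[e].
  rewrite [X in `[X] <= _]pa_pb (le_trans (sip_normD ipP _ _))//.
  by apply: le_trans (lerD pag pbg) _; lra.
(* As [f] is orthogonal to [one], [|f|^2 = <f, g>], so [f] is no larger than [g]. *)
have : `[f] ^+ 2 <= `[f] * `[g].
  rewrite sqr_sip_norm// (_ : ip f f = ip f g).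
    by rewrite (le_trans (ler_norm _))// sip_le_norm.
  by rewrite /g sipBr// sipZr// f1 mulr0 subr0.
have := nrm0 f; rewrite le_eqVlt => /orP[/eqP <- _|f0].
  by rewrite !mulr_ge0// ltW// addr_gt0// mulr_gt0.
by rewrite expr2 ler_pM2l// => /le_trans; apply.
Qed.

End atom_resolvent.

(** * Integration against mixtures of measures *)

Section mixture.
Context d d' d'' (X : measurableType d) (Y : measurableType d')
  (Z : measurableType d'') (R : realType).
Context (mu : {measure set X -> \bar R}).
Context (nu : {measure set Y -> \bar R}) (K : Y -> {measure set X -> \bar R}).
Context (nu' : {measure set Z -> \bar R}) (K' : Z -> {measure set X -> \bar R}).
Hypothesis mK : forall U, measurable U -> measurable_fun [set: Y] (K ^~ U).
Hypothesis mK' : forall U, measurable U -> measurable_fun [set: Z] (K' ^~ U).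
Local Open Scope ereal_scope.

Import HBNNSimple.

Let nnsfun_mixture d0 (W : measurableType d0) (m : {measure set W -> \bar R})
    (L : W -> {measure set X -> \bar R}) (f : {nnsfun X >-> R}) :
  (forall U, measurable U -> measurable_fun [set: W] (L ^~ U)) ->
  \int[m]_y \int[L y]_x (f x)%:E =
  \sum_(r \in range f) r%:E * \int[m]_y L y (f @^-1` [set r]).
Proof.
move=> mL; under eq_integral do rewrite integralT_nnsfun sintegralE.
have mLf r : measurable_fun setT (fun y => L y (f @^-1` [set r])) by exact: mL.
rewrite ge0_integral_fsum//; last 2 first.
- by move=> r; apply: measurable_funeM.
- by move=> r y _; exact: nnsfun_mulemu_ge0.
apply: eq_fsbigr => r /set_mem[x _ <-].
by rewrite ge0_integralZl ?lee_fin.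
Qed.

Let mixture_lim d0 (W : measurableType d0) (m : {measure set W -> \bar R})
    (L : W -> {measure set X -> \bar R}) (g : X -> \bar R)
    (mg : measurable_fun setT g) :
  (forall U, measurable U -> measurable_fun [set: W] (L ^~ U)) ->
  (forall x, 0 <= g x) ->
  \int[m]_y \int[L y]_x g x =
  limn (fun n => \int[m]_y \int[L y]_x (nnsfun_approx measurableT mg n x)%:E).
Proof.
move=> mL g0; pose g_ := nnsfun_approx measurableT mg.
have mg_ n : measurable_fun setT (fun x => (g_ n x)%:E) by exact/measurable_EFinP.
have g_0 n x : 0 <= (g_ n x)%:E by rewrite lee_fin.
have nd_g_ x : {homo (fun n => (g_ n x)%:E) : a b / (a <= b)%N >-> a <= b}.
  by move=> a b ab; rewrite lee_fin; exact/lefP/nd_nnsfun_approx.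
have gE y : \int[L y]_x g x = limn (fun n => \int[L y]_x (g_ n x)%:E).
  rewrite -monotone_convergence//; apply: eq_integral => x _.
  by apply/esym/cvg_lim => //; exact: cvg_nnsfun_approx.
under eq_integral do rewrite gE.
rewrite monotone_convergence//.
- by move=> n; exact: measurable_fun_integral_kernel.
- by move=> n y _; exact: integral_ge0.
- by move=> y _ a b ab; apply: ge0_le_integral => // x _; exact: nd_g_.
Qed.

Lemma eq_ge0_integral_mixture (g : X -> \bar R) :
  (forall B, measurable B -> \int[nu]_y K y B = \int[nu']_z K' z B) ->
  (forall x, 0 <= g x) -> measurable_fun setT g ->
  \int[nu]_y \int[K y]_x g x = \int[nu']_z \int[K' z]_x g x.
Proof.
move=> KK' g0 mg; rewrite !(mixture_lim _ mg)//.
apply: (congr1 (fun u : nat -> \bar R => limn u)); apply/funext => n; rewrite !nnsfun_mixture//.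
by apply: eq_fsbigr => r _; rewrite KK'.
Qed.

Hypothesis muE : forall B, measurable B -> mu B = \int[nu]_y K y B.

Lemma ge0_integral_mixture (g : X -> \bar R) :
  (forall x, 0 <= g x) -> measurable_fun setT g ->
  \int[mu]_x g x = \int[nu]_y \int[K y]_x g x.
Proof.
move=> g0 mg; rewrite (mixture_lim _ mg)//.
pose g_ := nnsfun_approx measurableT mg.
transitivity (limn (fun n => \int[mu]_x (g_ n x)%:E)).
  rewrite -monotone_convergence//.
  - apply: eq_integral => x _.
    by apply/esym/cvg_lim => //; exact: cvg_nnsfun_approx.
  - by move=> n; exact/measurable_EFinP.
  - by move=> n x _; rewrite lee_fin.
  - by move=> x _ a b ab; rewrite lee_fin; exact/lefP/nd_nnsfun_approx.
apply: (congr1 (fun u : nat -> \bar R => limn u)); apply/funext => n.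
rewrite nnsfun_mixture// integralT_nnsfun sintegralE.
by apply: eq_fsbigr => r _; rewrite muE.
Qed.

(** Fubini for mixtures: the nonnegative case applied to [|f|] gives the integrability, and applied
    to the positive and negative parts it gives the equality. It serves both the steps of the chain
    and the invariance of [pi]. *)
Lemma integrable_mixture (f : X -> R) : mu.-integrable setT (EFin \o f) ->
  [/\ {ae nu, forall y, (K y).-integrable setT (EFin \o f)},
    nu.-integrable setT (fun y => (\int[K y]_x f x)%:E) &
    (\int[mu]_x f x = \int[nu]_y (\int[K y]_x f x))%R].
Proof.
move=> /integrableP[mf intf].
have mabs : measurable_fun setT (fun x => `|(f x)%:E|) by exact: measurableT_comp.
have mP : measurable_fun setT (fun y => \int[K y]_x (EFin \o f)^\+ x).
  by apply: measurable_fun_integral_kernel => //; exact: measurable_funepos.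
have mN : measurable_fun setT (fun y => \int[K y]_x (EFin \o f)^\- x).
  by apply: measurable_fun_integral_kernel => //; exact: measurable_funeneg.
have mint : measurable_fun setT (fun y => \int[K y]_x (f x)%:E).
  under eq_fun do rewrite integralE.
  exact: emeasurable_funB.
have mA : measurable_fun setT (fun y => \int[K y]_x `|(f x)%:E|).
  by apply: measurable_fun_integral_kernel.
have intA : nu.-integrable setT (fun y => \int[K y]_x `|(f x)%:E|).
  apply/integrableP; split => //.
  under eq_integral do rewrite gee0_abs ?integral_ge0//.
  by rewrite -ge0_integral_mixture.
have aeint : {ae nu, forall y, (K y).-integrable setT (EFin \o f)}.
  have := integrable_ae measurableT intA; apply: filterS => y /(_ Logic.I).
  rewrite ge0_fin_numE ?integral_ge0// => h.
  by apply/integrableP.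
have mR : measurable_fun setT (fun y => ((\int[K y]_x f x)%R)%:E).
  by apply/measurable_EFinP; exact: measurableT_comp.
have intR : nu.-integrable setT (fun y => ((\int[K y]_x f x)%R)%:E).
  apply: (le_integrable measurableT _ _ intA) => // y _.
  rewrite [leRHS]gee0_abs ?integral_ge0//.
  have := le_abse_integral (K y) measurableT mf; apply: le_trans.
  (* Where the inner integral is infinite, [fine] returns [0] and the bound still holds. *)
  by rewrite /Rintegral abse_EFin; case: (\int[K y]_x _) => //= *; rewrite ?normr0 ?leey.
split => //; rewrite /Rintegral; congr fine.
transitivity (\int[nu]_y \int[K y]_x (f x)%:E); last first.
  apply: ae_eq_integral => //.
  apply: filterS aeint => y fy _; rewrite fineK//.
  exact: integrable_fin_num.
rewrite integralE.
have intPN (h : X -> \bar R) : (forall x, 0 <= h x <= `|(f x)%:E|) ->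
    measurable_fun setT h -> nu.-integrable setT (fun y => \int[K y]_x h x).
  move=> hf mh; have h0 x : 0 <= h x by have /andP[] := hf x.
  have mI : measurable_fun setT (fun y => \int[K y]_x h x).
    exact: measurable_fun_integral_kernel.
  apply: (le_integrable measurableT _ _ intA) => // y _.
  rewrite !gee0_abs ?integral_ge0//; apply: ge0_le_integral => // x _.
  by have /andP[] := hf x.
have absE x : `|(f x)%:E| = (EFin \o f)^\+ x + (EFin \o f)^\- x.
  by rewrite -[RHS]/(((EFin \o f)^\+ \+ (EFin \o f)^\-) x) -fune_abse.
rewrite (@ge0_integral_mixture (EFin \o f)^\+)//; last exact: measurable_funepos.
rewrite (@ge0_integral_mixture (EFin \o f)^\-)//; last exact: measurable_funeneg.
rewrite -integralB//.
- by apply: eq_integral => y _; rewrite [RHS]integralE.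
- apply: intPN; last exact: measurable_funepos.
  by move=> x; rewrite funepos_ge0 absE leeDl.
- apply: intPN; last exact: measurable_funeneg.
  by move=> x; rewrite funeneg_ge0 absE leeDr.
Qed.

End mixture.

(** * Bounded measurable functions *)

Section bounded_measurable.
Context d (X : measurableType d) (R : realType).

Definition bmeas : {pred X -> R} :=
  mem [set f : X -> R | measurable_fun setT f /\ exists M, forall x, `|f x| <= M].

(** Bounded measurable functions are integrable against every probability, so averaging over a
    kernel is defined at every point and stays within the space. *)
Record bfun := BFun { bfun_val :> X -> R; _ : bfun_val \in bmeas }.

HB.instance Definition _ := [isSub for bfun_val].
HB.instance Definition _ := [Choice of bfun by <:].

Lemma bmeasP (f : X -> R) : measurable_fun setT f ->
  (exists M, forall x, `|f x| <= M) -> f \in bmeas.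
Proof. by move=> mf bf; apply/mem_set. Qed.

Lemma measurable_bfun (f : bfun) : measurable_fun setT f.
Proof. by case: f => f /= /set_mem[]. Qed.

Lemma bfun_bounded (f : bfun) : exists2 M : R, 0 < M & forall x, `|f x| <= M.
Proof.
case: f => f /= /set_mem[_ [M fM]]; exists (`|M| + 1) => [|x].
  by rewrite ltr_wpDl.
by rewrite (le_trans (fM x))// (le_trans (ler_norm _))// lerDl.
Qed.

Lemma bmeas_submod_closed : submod_closed bmeas.
Proof.
split.
  by apply: bmeasP; [exact: measurable_cst|exists 0 => x; rewrite normr0].
move=> c f g /set_mem[mf [M fM]] /set_mem[mg [N gN]]; apply: bmeasP.
  by apply: measurable_funD => //; exact: measurable_funM.
exists (`|c| * M + N) => x; rewrite (le_trans (ler_normD _ _))// lerD//.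
by rewrite normrM ler_wpM2l.
Qed.

HB.instance Definition _ := GRing.isSubmodClosed.Build R (X -> R) bmeas
  bmeas_submod_closed.
HB.instance Definition _ := [SubChoice_isSubLmodule of bfun by <:].

Lemma bfunP (f g : bfun) : (forall x, f x = g x) -> f = g.
Proof. by move=> fg; apply/val_inj/funext. Qed.

Lemma bfunD (f g : bfun) x : (f + g) x = f x + g x.
Proof. by []. Qed.

Lemma bfunB (f g : bfun) x : (f - g) x = f x - g x.
Proof. by []. Qed.

Lemma bfunZ c (f : bfun) x : (c *: f) x = c * f x.
Proof. by []. Qed.

Lemma bmeasM (f g : bfun) : (fun x => f x * g x) \in bmeas.
Proof.
have [M M0 fM] := bfun_bounded f; have [N N0 gN] := bfun_bounded g.
apply: bmeasP; first by apply: measurable_funM; exact: measurable_bfun.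
by exists (M * N) => x; rewrite normrM ler_pM.
Qed.

Definition bmul (f g : bfun) : bfun := BFun (bmeasM f g).

Lemma bmul_is_linear f : linear (bmul f).
Proof. by move=> c g h; apply: bfunP => x /=; rewrite mulrDr mulrCA. Qed.

HB.instance Definition _ f := GRing.isLinear.Build R bfun bfun _ (bmul f)
  (bmul_is_linear f).

Lemma bmeas1 : (fun=> 1 : R) \in bmeas.
Proof.
by apply: bmeasP; [exact: measurable_cst|exists 1 => x; rewrite normr1].
Qed.

Definition bone : bfun := BFun bmeas1.

Lemma bmeas_indic (A : set X) : measurable A -> (\1_A : X -> R) \in bmeas.
Proof.
move=> mA; apply: bmeasP; first exact: measurable_indic.
by exists 1 => x; rewrite ger0_norm ?indicE ?lern1 ?leq_b1.
Qed.

Definition bindic (A : set X) (mA : measurable A) : bfun := BFun (bmeas_indic mA).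

Lemma integrable_bfun (mu : {measure set X -> \bar R}) (f : bfun) :
  (mu setT < +oo)%E -> mu.-integrable setT (EFin \o f).
Proof.
move=> mufin; apply: measurable_bounded_integrable => //.
  exact: measurable_bfun.
have [M M0 fM] := bfun_bounded f; exists M; split; first exact: num_real.
by move=> N MN x _; apply: le_trans (fM x) _; exact: ltW.
Qed.

Lemma integral_bfun (mu : {measure set X -> \bar R}) (f : bfun) :
  (mu setT < +oo)%E -> (\int[mu]_x (f x)%:E)%E = (\int[mu]_x f x)%:E.
Proof.
move=> mufin; rewrite /Rintegral fineK//.
by apply: integrable_fin_num => //; exact: integrable_bfun.
Qed.

Section finite_measure.
Context (mu : {measure set X -> \bar R}).
Hypothesis mufin : (mu setT < +oo)%E.

Lemma Rintegral_bfun_linear c (f g : bfun) :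
  \int[mu]_x (c *: f + g) x = c * \int[mu]_x f x + \int[mu]_x g x.
Proof.
rewrite RintegralD//; first by rewrite RintegralZl//; exact: integrable_bfun.
- exact: (integrable_bfun (c *: f)).
- exact: integrable_bfun.
Qed.

Lemma le_Rintegral_bfun (f g : bfun) : (forall x, f x <= g x) ->
  \int[mu]_x f x <= \int[mu]_x g x.
Proof.
by move=> fg; apply: le_Rintegral => //; exact: integrable_bfun.
Qed.

Lemma Rintegral_bone : \int[mu]_x bone x = fine (mu setT).
Proof. by rewrite -[RHS]mul1r -(Rintegral_cst mu measurableT). Qed.

Lemma norm_Rintegral_bfun_le (f : bfun) M : (forall x, `|f x| <= M) ->
  `|\int[mu]_x f x| <= M * fine (mu setT).
Proof.
move=> fM; have MfM x : - M <= f x <= M by rewrite -ler_norml.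
have cst_int c : \int[mu]_x (c *: bone) x = c * fine (mu setT).
  rewrite -(Rintegral_cst mu measurableT).
  by apply: eq_Rintegral => x _; rewrite bfunZ mulr1.
rewrite ler_norml -mulNr -!cst_int; apply/andP; split;
  by apply: le_Rintegral_bfun => x; rewrite bfunZ mulr1; case/andP: (MfM x).
Qed.

End finite_measure.

End bounded_measurable.

(** * The averaging operator of a kernel *)

Section kernel_average.
Context d (X : measurableType d) (R : realType) (P : R.-pker X ~> X).
Local Notation bfun := (bfun X R).

Lemma pker_lty x : (P x setT < +oo)%E.
Proof. by rewrite prob_kernel ltry. Qed.

Lemma measurable_average (f : X -> R) : measurable_fun setT f ->
  measurable_fun setT (fun x => \int[P x]_y f y).
Proof.
move=> /measurable_EFinP mf; apply: measurableT_comp => //.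
under eq_fun do rewrite integralE.
apply: emeasurable_funB; apply: measurable_fun_integral_kernel => //.
- by move=> U mU; exact: measurable_kernel.
- exact: measurable_funepos.
- by move=> U mU; exact: measurable_kernel.
- exact: measurable_funeneg.
Qed.

Lemma bmeas_average (f : bfun) : (fun x => \int[P x]_y f y) \in @bmeas _ X R.
Proof.
apply: bmeasP; first by apply: measurable_average; exact: measurable_bfun.
have [M M0 fM] := bfun_bounded f; exists M => x.
have := norm_Rintegral_bfun_le (pker_lty x) fM.
by rewrite prob_kernel mulr1.
Qed.

Definition bavg (f : bfun) : bfun := BFun (bmeas_average f).

Lemma bavg_is_linear : linear bavg.
Proof.
by move=> c f g; apply: bfunP => x /=; rewrite Rintegral_bfun_linear ?pker_lty.
Qed.

HB.instance Definition _ := GRing.isLinear.Build R bfun bfun _ bavg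
  bavg_is_linear.

Lemma bavg1 : bavg (bone X R) = bone X R.
Proof.
by apply: bfunP => x /=; rewrite Rintegral_bone ?pker_lty// prob_kernel.
Qed.

Lemma le_bavg (f g : bfun) : (forall x, f x <= g x) ->
  forall x, bavg f x <= bavg g x.
Proof. by move=> fg x; apply: le_Rintegral_bfun => //; exact: pker_lty. Qed.

End kernel_average.

Section inner_product.
Context d (X : measurableType d) (R : realType) (pi : probability X R).
Local Notation bfun := (bfun X R).

Lemma prob_lty : (pi setT < +oo)%E.
Proof. by rewrite probability_setT ltry. Qed.

Definition bip (f g : bfun) : R := \int[pi]_x bmul f g x.

Lemma bip_sip : semi_inner_product bip.
Proof.
have lin c (f g h : bfun) : bip (c *: f + g) h = c * bip f h + bip g h.
  rewrite /bip -Rintegral_bfun_linear ?prob_lty//; apply: eq_Rintegral => x _.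
  by rewrite bfunD bfunZ /= mulrDl mulrA.
have ip0 h : bip 0 h = 0.
  have := lin 1 0 0 h; rewrite scale1r addr0 mul1r => /eqP.
  by rewrite -subr_eq0 opprD addrA subrr add0r oppr_eq0 => /eqP.
split.
- by move=> f g; apply: eq_Rintegral => x _ /=; rewrite mulrC.
- by move=> f g h; rewrite -[f]scale1r lin mul1r scale1r.
- by move=> c f h; rewrite -[c *: f]addr0 lin ip0 addr0.
- by move=> f; apply: Rintegral_ge0 => x _ /=; rewrite -expr2 sqr_ge0.
Qed.

Lemma bip1 (f : bfun) : bip f (bone X R) = \int[pi]_x f x.
Proof. by apply: eq_Rintegral => x _ /=; rewrite mulr1. Qed.

Lemma bip_bindic (A : set X) (mA : measurable A) :
  bip (bindic R mA) (bindic R mA) = fine (pi A).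
Proof.
rewrite -[in RHS](setIT A) -integral_indic// -[RHS]/(Rintegral _ _ _).
by apply: eq_Rintegral => x _ /=; rewrite indicE; case: (_ \in _); rewrite ?mulr1 ?mulr0.
Qed.

End inner_product.

(** * Reversibility as self-adjointness *)

Section reversible.
Context d (X : measurableType d) (R : realType) (P : R.-pker X ~> X).
Context (pi : probability X R).
Local Notation bfun := (bfun X R).

Lemma bip_bavg (f g : bfun) : reversible P pi ->
  bip pi (bavg P f) g = bip pi f (bavg P g).
Proof.
move=> revP.
suff ge0 (u v : bfun) : (forall x, 0 <= u x) -> (forall x, 0 <= v x) ->
    bip pi (bavg P u) v = bip pi u (bavg P v).
  (* Adding constants makes both functions nonnegative; the extra terms cancel by the identity for
     pairs in which one function is [bone]. *)
  have [M M0 fM] := bfun_bounded f; have [N N0 gN] := bfun_bounded g.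
  have fM0 x : 0 <= (f + M *: bone X R) x.
    by rewrite bfunD bfunZ mulr1; have := fM x; rewrite ler_norml; lra.
  have gN0 x : 0 <= (g + N *: bone X R) x.
    by rewrite bfunD bfunZ mulr1; have := gN x; rewrite ler_norml; lra.
  have o0 x : 0 <= bone X R x by [].
  have sip := bip_sip pi.
  have := ge0 _ _ fM0 gN0; have := ge0 _ _ o0 gN0; have := ge0 _ _ fM0 o0.
  have := ge0 _ _ o0 o0.
  rewrite !(linearD, linearZ, sipDl sip, sipDr sip, sipZl sip, sipZr sip)/=.
  rewrite !bavg1 => _ /addIr -> /addIr -> /addIr.
  by move/addIr.
move=> u0 v0.
have mpair1 x : measurable_fun [set: X] (pair x : X -> X * X) by [].
have mpair2 x : measurable_fun [set: X] (pair^~ x : X -> X * X) by [].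
(* Reversibility on sets of pairs is an equality of two mixtures of measures on
   [X * X], hence extends to the function [(x, y) |-> u x * v y]. *)
pose K0 x : {measure set (X * X) -> \bar R} := pushforward (P x) (pair x).
pose K := K0 mpair1.
pose K'0 y : {measure set (X * X) -> \bar R} := pushforward (P y) (pair^~ y).
pose K' := K'0 mpair2.
have KE x U : K x U = P x (xsection U x) by rewrite xsectionE.
have K'E y U : K' y U = P y (ysection U y) by rewrite ysectionE.
have mK U : measurable U -> measurable_fun [set: X] (K ^~ U).
  move=> mU; under eq_fun do rewrite KE.
  by apply: (measurable_fun_xsection_finite_kernel P); exact/mem_set.
have mK' U : measurable U -> measurable_fun [set: X] (K' ^~ U).
  move=> mU; under eq_fun do rewrite K'E.
  rewrite (_ : (fun y => _) = fun y => P y (xsection (unstable.swap @^-1` U) y)).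
    apply: (measurable_fun_xsection_finite_kernel P); apply/mem_set.
    by rewrite -[X in measurable X]setTI; exact: measurable_swap.
  by apply/funext => y; rewrite xsectionE ysectionE.
have mh : measurable_fun setT (fun z : X * X => (u z.1 * v z.2)%:E).
  apply/measurable_EFinP; apply: measurable_funM.
  - by apply: (measurableT_comp (measurable_bfun u)).
  - by apply: (measurableT_comp (measurable_bfun v)).
have h0 (z : X * X) : (0 <= (u z.1 * v z.2)%:E)%E by rewrite lee_fin mulr_ge0.
have := eq_ge0_integral_mixture mK mK' _ h0 mh (nu := pi) (nu' := pi).
have KK' B : measurable B -> (\int[pi]_y K y B = \int[pi]_z K' z B)%E.
  by move=> mB; under eq_integral do rewrite KE;
     under [RHS]eq_integral do rewrite K'E; exact: revP.
move=> /(_ KK').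
have -> : (\int[pi]_y \int[K y]_x (u x.1 * v x.2)%:E)%E = (bip pi u (bavg P v))%:E.
  rewrite /bip -integral_bfun ?prob_lty//; apply: eq_integral => x _ /=.
  rewrite EFinM -integral_bfun ?pker_lty// -ge0_integralZl_EFin//.
  - by rewrite ge0_integral_pushforward// preimage_setT.
  - by move=> y _; rewrite lee_fin.
  - by apply/measurable_EFinP; exact: measurable_bfun.
have -> : (\int[pi]_y \int[K' y]_x (u x.1 * v x.2)%:E)%E = (bip pi (bavg P u) v)%:E.
  rewrite /bip -integral_bfun ?prob_lty//; apply: eq_integral => x _ /=.
  rewrite mulrC EFinM -integral_bfun ?pker_lty// -ge0_integralZl_EFin//.
  - rewrite ge0_integral_pushforward// preimage_setT.
    by apply: eq_integral => y _ /=; rewrite mulrC EFinM.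
  - by move=> y _; rewrite lee_fin.
  - by apply/measurable_EFinP; exact: measurable_bfun.
by move=> [->].
Qed.

End reversible.

(** * First return to a set *)

Lemma ge0_integral_mrestr d (T : measurableType d) (R : realType)
    (mu : {measure set T -> \bar R}) (C : set T) (mC : measurable C)
    (g : T -> \bar R) : (forall x, 0 <= g x)%E -> measurable_fun setT g ->
  (\int[mrestr mu mC]_x g x = \int[mu]_(x in C) g x)%E.
Proof.
move=> g0 mg; rewrite (@ge0_negligible_integral _ _ _ _ setT (~` C))//.
- rewrite setTD setCK; apply: eq_measure_integral => B mB BC.
  by rewrite /= /mrestr setIidl.
- exact: measurableC.
- by rewrite /= /mrestr setICl measure0.
Qed.

Section markov_chain.
Context d d' (X : measurableType d) (Omega : measurableType d') (R : realType).
Context (P : R.-pker X ~> X) (Pr : X -> probability Omega R).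
Context (Phi : nat -> {mfun Omega >-> X}).
Hypothesis chain : markov_chain P Pr Phi.
Local Notation bfun := (bfun X R).
Local Notation T := (bavg P).

Lemma natural_filtrationT n : natural_filtration Phi n setT.
Proof.
exact: (@measurableT _ (g_sigma_algebraType [set C | exists i B,
  [/\ (i <= n)%N, measurable B & C = Phi i @^-1` B]])).
Qed.

Lemma Rintegral_nstep n x (f : bfun) :
  \int[nstep Pr Phi n x]_y f y = iter n T f x.
Proof.
elim: n f => [|n IHn] f.
  rewrite /Rintegral (@eq_measure_integral _ _ _ _ \d_x).
    have mf : measurable_fun setT (EFin \o f).
      by apply/measurable_EFinP; exact: measurable_bfun.
    by rewrite (integral_dirac x measurableT mf) diracT mul1e.
  by move=> B mB _; exact: (chain.1 x B mB).
rewrite iterSr -IHn.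
have stepE B : measurable B ->
    nstep Pr Phi n.+1 x B = (\int[nstep Pr Phi n x]_y P y B)%E.
  move=> mB; rewrite ge0_integral_pushforward//; last exact: measurable_kernel.
  rewrite preimage_setT -chain.2//; first by rewrite setTI.
  exact: natural_filtrationT.
have [|_ _ ->//] := integrable_mixture (measurable_kernel P) stepE (f := f).
by apply: integrable_bfun; exact: prob_lty.
Qed.

Lemma measurable_natural_filtration n C :
  natural_filtration Phi n C -> measurable C.
Proof.
apply: smallest_sub; first exact: sigma_algebra_measurable.
move=> _ [i [B [_ mB ->]]].
by rewrite -[X in measurable X]setTI; exact: measurable_funPT.
Qed.

Lemma ge0_markov_step x n C (g : bfun) :
  natural_filtration Phi n C -> (forall y, 0 <= g y) ->
  (\int[Pr x]_(w in C) (g (Phi n.+1 w))%:E =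
   \int[Pr x]_(w in C) (T g (Phi n w))%:E)%E.
Proof.
move=> FC g0; have mC := measurable_natural_filtration FC.
have Tg0 y : 0 <= T g y by apply: Rintegral_ge0.
have mE (f : bfun) : measurable_fun setT (fun y => (f y)%:E).
  by apply/measurable_EFinP; exact: measurable_bfun.
have mPhi m : measurable_fun setT (Phi m) by exact: measurable_funPT.
(* [nu m] is the law of [Phi m] on the event [C]. The Markov property makes [nu n.+1] the mixture of
   the [P y] under [nu n], which extends it from sets to functions. *)
pose nu0 m : {measure set X -> \bar R} := pushforward (mrestr (Pr x) mC) (Phi m).
pose nu := nu0 mPhi.
have nuE m (f : X -> \bar R) : (forall y, 0 <= f y)%E -> measurable_fun setT f ->
    (\int[nu m]_y f y = \int[Pr x]_(w in C) f (Phi m w))%E.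
  move=> f0 mf; rewrite ge0_integral_pushforward// preimage_setT.
  rewrite ge0_integral_mrestr//; first by move=> w /=.
  exact: measurableT_comp.
have stepE B : measurable B -> nu n.+1 B = (\int[nu n]_y P y B)%E.
  move=> mB; rewrite nuE//; last exact: measurable_kernel.
  by rewrite -chain.2// /nu/= /pushforward /mrestr setIC.
transitivity (\int[nu n.+1]_y (g y)%:E)%E; first by rewrite nuE.
transitivity (\int[nu n]_y (T g y)%:E)%E; last by rewrite nuE.
have g0' y : (0 <= (g y)%:E)%E by rewrite lee_fin.
rewrite (ge0_integral_mixture (measurable_kernel P) stepE g0' (mE g)).
by apply: eq_integral => y _; rewrite -integral_bfun ?pker_lty.
Qed.

Context (A : set X) (mA : measurable A).

Definition bcompl : bfun := bone X R - bindic R mA.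
Local Notation pb := (bmul bcompl).

Lemma bcomplE x : bcompl x = \1_(~` A) x.
Proof. by rewrite /bcompl bfunB /= !indicE in_setC; case: (x \in A); rewrite ?subrr ?subr0. Qed.

(** Time [0] is left free, since [tau] counts visits from time [1] on. *)
Definition avoid N : set Omega :=
  [set w | forall i, (0 < i <= N)%N -> ~ A (Phi i w)].

Lemma avoidS N : avoid N.+1 = avoid N `&` Phi N.+1 @^-1` (~` A).
Proof.
apply/seteqP; split => w.
  move=> wN; split; last by apply: wN; rewrite ltn0Sn leqnn.
  by move=> i /andP[i0 iN]; apply: wN; rewrite i0 leqW.
move=> [wN wA] i /andP[i0]; rewrite leq_eqVlt => /predU1P[->//|iN].
by apply: wN; rewrite i0.
Qed.

Lemma avoid0 : avoid 0 = setT.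
Proof. by apply/seteqP; split => // w _ [|i]. Qed.

Lemma avoid_natural_filtration N n : (N <= n)%N ->
  natural_filtration Phi n (avoid N).
Proof.
elim: N => [_|N IHN Nn]; first by rewrite avoid0; exact: natural_filtrationT.
rewrite avoidS.
have : @measurable _ (g_sigma_algebraType [set C | exists i B,
  [/\ (i <= n)%N, measurable B & C = Phi i @^-1` B]]) (avoid N `&` Phi N.+1 @^-1` (~` A)).
  apply: measurableI; first by apply: IHN; exact: ltnW.
  apply: sub_sigma_algebra; exists N.+1, (~` A); split => //.
  exact: measurableC.
by [].
Qed.

Lemma measurable_avoid N : measurable (avoid N).
Proof. exact: measurable_natural_filtration (avoid_natural_filtration (leqnn N)). Qed.

(** The path is averaged out from its end: the last step turns [g] into [T g], the condition at the
    time before it multiplies by the indicator of the complement, and the induction goes on with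
    [pb (T g)]. *)
Lemma integral_avoid x N (g : bfun) : (forall y, 0 <= g y) ->
  (\int[Pr x]_(w in avoid N) (g (Phi N.+1 w))%:E =
   (iter N (T \o pb) (T g) x)%:E)%E.
Proof.
elim: N g => [|N IHN] g g0.
  rewrite ge0_markov_step//; last exact: avoid_natural_filtration.
  transitivity (iter 0 T (T g) x)%:E => //.
  have mTg : measurable_fun setT (EFin \o T g).
    by apply/measurable_EFinP; exact: measurable_bfun.
  rewrite -Rintegral_nstep -integral_bfun ?prob_lty//.
  rewrite ge0_integral_pushforward// ?preimage_setT ?avoid0// => y _.
  by rewrite lee_fin; apply: Rintegral_ge0.
rewrite ge0_markov_step//; last exact: avoid_natural_filtration.
have Tg0 y : 0 <= T g y by apply: Rintegral_ge0.
have pbE y : pb (T g) y = \1_(~` A) y * T g y by rewrite -bcomplE.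
rewrite iterSr -[RHS]IHN; last by move=> y; rewrite pbE mulr_ge0.
rewrite avoidS integral_mkcondr; apply: eq_integral => w _.
rewrite patchE pbE indicE.
have -> : (w \in Phi N.+1 @^-1` (~` A)) = (Phi N.+1 w \in ~` A).
  by apply/idP/idP; rewrite !inE.
by case: (_ \in _); rewrite ?mul1r ?mul0r.
Qed.

(* [fret N x] is [P_x(tau = N+1)] and [surv N x] is [P_x(tau > N)], see
   [first_returnE] and [measure_avoid]. *)
Definition fret N : bfun := iter N (T \o pb) (T (bindic R mA)).
Definition surv N : bfun := iter N (T \o pb) (bone X R).

Let entry n := avoid n `&` Phi n.+1 @^-1` A.

Let measurable_entry n : measurable (entry n).
Proof.
apply: measurableI; first exact: measurable_avoid.
by rewrite -[X in measurable X]setTI; exact: measurable_funPT.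
Qed.

Lemma le_tau N w : avoid N w -> (N.+1%:R%:E <= tau R Phi A w)%E.
Proof.
move=> wN; apply: le_ereal_inf_tmp => _ [n [n0 An] <-].
rewrite lee_fin ler_nat ltnNge; apply/negP => nN.
by apply: (wN n) => //; rewrite n0.
Qed.

Lemma tauP n w : tau R Phi A w = n.+1%:R%:E <-> entry n w.
Proof.
split=> [tauE|[wn An]]; last first.
  apply/eqP; rewrite eq_le le_tau// andbT; apply: ereal_inf_lbound.
  by exists n.+1.
have wn : avoid n w.
  move=> i /andP[i0 iN] Ai.
  have : (tau R Phi A w <= i%:R%:E)%E by apply: ereal_inf_lbound; exists i.
  by rewrite tauE lee_fin ler_nat ltnNge iN.
split=> //; apply: contrapT => NAn.
have : (n.+2%:R%:E <= tau R Phi A w)%E by apply: le_tau; rewrite avoidS.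
by rewrite tauE lee_fin ler_nat ltnn.
Qed.

Lemma measure_entry x n : Pr x (entry n) = (fret n x)%:E.
Proof.
rewrite /fret -integral_avoid; last by move=> y /=.
transitivity (\int[Pr x]_(w in avoid n) (\1_(Phi n.+1 @^-1` A) w)%:E)%E.
  rewrite integral_indic//; first by rewrite setIC.
  exact: measurable_avoid.
  by rewrite -[X in measurable X]setTI; exact: measurable_funPT.
by apply: eq_integral => w _ /=.
Qed.

Lemma first_returnE x n : first_return Pr Phi n.+1 x A = (fret n x)%:E.
Proof.
rewrite -measure_entry; congr (Pr x _); apply/seteqP.
by split=> w /tauP.
Qed.

Lemma measure_avoid x N : Pr x (avoid N) = (surv N x)%:E.
Proof.
case: N => [|N]; first by rewrite avoid0 probability_setT.
have -> : surv N.+1 = iter N (T \o pb) (T bcompl).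
  rewrite /surv iterSr /=; congr (iter N _ (T _)).
  by apply: bfunP => y /=; rewrite mulr1.
rewrite -integral_avoid; last by move=> y; rewrite bcomplE.
transitivity (\int[Pr x]_(w in avoid N) (\1_(Phi N.+1 @^-1` (~` A)) w)%:E)%E.
  rewrite integral_indic//; first by rewrite setIC avoidS.
  exact: measurable_avoid.
  rewrite -[X in measurable X]setTI; apply: measurable_funPT => //.
  exact: measurableC.
by apply: eq_integral => w _; rewrite bcomplE.
Qed.

(** A bounded minorant of [k ^ tau]: exact where [tau <= N], and [k ^ N.+1] elsewhere, in particular
    where [tau] is infinite. Only finite sums remain. *)
Lemma le_integral_exp_tau (k : R) x N : 1 < k ->
  ((\sum_(n < N) k ^+ n.+1 * fret n x + k ^+ N.+1 * surv N x)%:E <=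
   \int[Pr x]_w exp_base k (tau R Phi A w))%E.
Proof.
move=> k1; have k0 : 0 < k by exact: lt_trans k1.
have exp_ge0 t : (0 <= exp_base k t)%E.
  by case: t => [r| |] //=; rewrite ?leey// lee_fin powR_ge0.
(* [S N] is [k ^ tau] where [tau <= N] and [0] on [avoid N]. *)
pose S N :=
  \sum_(n < N) k ^+ n.+1 *: bindic R (measurable_entry n).
have SS M : S M.+1 = S M + k ^+ M.+1 *: bindic R (measurable_entry M).
  by rewrite /S big_ord_recr.
have S00 : S 0 = 0 by rewrite /S big_ord0.
have S_ge0 M w : 0 <= S M w.
  elim: M => [|M IHM]; first by rewrite S00.
  by rewrite SS bfunD bfunZ addr_ge0// mulr_ge0 ?exprn_ge0 ?(ltW k0).
have SE M w : (avoid M w -> S M w = 0) /\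
    (~ avoid M w -> (S M w)%:E = exp_base k (tau R Phi A w)).
  elim: M => [|M [IH1 IH2]]; first by rewrite avoid0 S00; split=> // /(_ Logic.I).
  have SSw : S M.+1 w = S M w + k ^+ M.+1 * \1_(entry M) w by rewrite SS.
  have [wM|wM] := pselect (avoid M w); last first.
    split=> [|_]; first by rewrite avoidS => -[].
    by rewrite SSw indicE memNset ?mulr0 ?addr0 ?IH2// => -[].
  rewrite SSw IH1// add0r; split=> [|NwM].
    by rewrite avoidS => -[_ /= nA]; rewrite indicE memNset ?mulr0// => -[].
  have eM : entry M w.
    by split=> //; apply: contrapT => nA; apply: NwM; rewrite avoidS.
  have /tauP -> := eM.
  by rewrite indicE mem_set// mulr1 /= powR_mulrn ?(ltW k0).
have le_exp w : ((S N w + k ^+ N.+1 * \1_(avoid N) w)%:E <=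
    exp_base k (tau R Phi A w))%E.
  have [S0 S1] := SE N w.
  have [wN|wN] := pselect (avoid N w); last first.
    by rewrite indicE memNset// mulr0 addr0 S1.
  rewrite S0// add0r indicE mem_set// mulr1.
  have := le_tau wN; case: (tau R Phi A w) => [r| |] /=; rewrite ?leey ?leeNy_eq//.
  by rewrite !lee_fin => Nr; rewrite -powR_mulrn ?(ltW k0)// ler_powR// (ltW k1).
pose G := k ^+ N.+1 *: bindic R (measurable_avoid N) + S N.
have intS M : \int[Pr x]_w S M w = \sum_(n < M) k ^+ n.+1 * fret n x.
  elim: M => [|M IHM].
    by rewrite S00 big_ord0 -(mul0r (fine (Pr x setT))) -Rintegral_cst.
  rewrite SS addrC Rintegral_bfun_linear ?prob_lty// IHM big_ord_recr addrC/=.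
  congr (_ + _ * _); rewrite /Rintegral integral_indic//.
  rewrite setIT; exact: (congr1 fine (measure_entry x M)).
have intG : \int[Pr x]_w G w =
    \sum_(n < N) k ^+ n.+1 * fret n x + k ^+ N.+1 * surv N x.
  rewrite Rintegral_bfun_linear ?prob_lty// intS addrC; congr (_ + _ * _).
  rewrite /Rintegral integral_indic//; last exact: measurable_avoid.
  by rewrite setIT; exact: (congr1 fine (measure_avoid x N)).
(* The integral of a nonnegative function being the supremum of the integrals of
   the simple functions below it, monotonicity needs no measurability of [tau]. *)
rewrite -intG -integral_bfun ?prob_lty// !ge0_integralTE//.
  apply: ereal_sup_le => _ [h hG <-]; exists h => // w.
  by rewrite (le_trans (hG w))// /G bfunD bfunZ addrC.
move=> w; rewrite lee_fin /G bfunD bfunZ addr_ge0// mulr_ge0//.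
by rewrite exprn_ge0// ltW.
Qed.

End markov_chain.

(** * Reversible kernels with an atom *)

(** Markov's inequality: as [m] tends to [0], [m N] is the sum of the [u n] over [n >= N], whose
    weights [k ^ n.+1] are at least [k ^ N.+1]. It is applied to survival both at a point and in
    equilibrium. *)
Lemma tail_le_moment (R : realType) (k s : R) (m u : nat -> R) :
  1 < k -> (forall n, 0 <= u n) -> (forall n, m n.+1 = m n - u n) ->
  (forall N, \sum_(n < N) k ^+ n.+1 * u n <= s) -> m @ \oo --> 0 ->
  forall N, m N <= s * k ^- N.+1.
Proof.
move=> k1 u0 mS us m0 N; have k0 : 0 < k by exact: lt_trans k1.
have tail M : m N <= s * k ^- N.+1 + m (N + M)%N.
  have -> : m N = \sum_(n < M) u (N + n)%N + m (N + M)%N.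
    elim: M => [|M IHM]; first by rewrite big_ord0 add0r addn0.
    by rewrite big_ord_recr addnS mS /= -addrA [X in _ + X]addrC subrK.
  rewrite lerD2r ler_pdivlMr ?exprn_gt0// mulrC mulr_sumr.
  rewrite (le_trans _ (us (N + M)%N))// big_split_ord/=.
  rewrite ler_wpDl//.
    by apply: sumr_ge0 => i _; rewrite mulr_ge0 ?exprn_ge0 ?(ltW k0).
  apply: ler_sum => i _; rewrite ler_wpM2r//.
  by rewrite ler_weXn2l ?(ltW k1)// ltnS leq_addr.
have : (fun M => s * k ^- N.+1 + m (N + M)%N) @ \oo --> s * k ^- N.+1 + 0.
  apply: cvgD; first exact: cvg_cst.
  by move: m0; rewrite -(cvg_shiftn N) /=; under eq_fun do rewrite addnC.
rewrite addr0 => mc; rewrite -(cvg_lim _ mc)//.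
by apply: limr_ge; [apply/cvg_ex; eexists; exact: mc|exact: nearW].
Qed.

(* [moment] is the truncated form of [E_x0 (kappa ^ tau) <= S], see
   [le_integral_exp_tau]; [T_atom] says that [A] is an atom. *)
Section reversible_atom.
Context d (X : measurableType d) (R : realType) (P : R.-pker X ~> X).
Context (pi : probability X R) (A : set X) (mA : measurable A) (x0 : X).
Context (kappa S : R).
Local Notation bfun := (bfun X R).
Local Notation T := (bavg P).
Local Notation one := (bone X R).
Local Notation a := (bindic R mA).
Local Notation b := (bcompl R mA).
Local Notation pa := (bmul a).
Local Notation pb := (bmul b).
Local Notation Q := (pb \o T \o pb).
Local Notation fret := (fret P mA).
Local Notation surv := (surv P mA).
Local Notation ip := (bip pi).
Local Notation "`[ f ]" := (sip_norm ip f) (at level 0, format "`[ f ]").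
Hypothesis T_rev : reversible P pi.
Hypothesis A_x0 : A x0.
Hypothesis T_atom : forall x, A x -> forall f : bfun, T f x = T f x0.
Hypothesis pi_A : 0 < fine (pi A).
Hypothesis kappa_gt1 : 1 < kappa.
Hypothesis moment : forall N,
  \sum_(n < N) kappa ^+ n.+1 * fret n x0 + kappa ^+ N.+1 * surv N x0 <= S.
Hypothesis T_irr : forall B (mB : measurable B), (0 < pi B)%E ->
  exists n, 0 < iter n T (bindic R mB) x0.

Let k0 : 0 < kappa. Proof. exact: lt_trans kappa_gt1. Qed.
Let sip := bip_sip pi.

Lemma bcompl_notin x : ~ A x -> b x = 1.
Proof. by move=> Ax; rewrite bcomplE indicE mem_set. Qed.

Lemma bcompl_ge0 x : 0 <= b x.
Proof. by rewrite bcomplE. Qed.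

Lemma bcompl_le1 x : b x <= 1.
Proof. by rewrite bcomplE indicE lern1 leq_b1. Qed.

Lemma bcompl_idem x : b x * b x = b x.
Proof. by rewrite bcomplE indicE; case: (_ \in _); rewrite ?mulr1 ?mulr0. Qed.

Lemma bmul_bcomplE f : pb f = f - pa f.
Proof.
by apply: bfunP => x; transitivity ((1 - \1_A x) * f x); rewrite // mulrBl mul1r.
Qed.

Lemma bmul_bcompl_idem f : pb (pb f) = pb f.
Proof. by apply: bfunP => x /=; rewrite mulrA bcompl_idem. Qed.

Lemma bmul_bindic_idem f : pa (pa f) = pa f.
Proof.
apply: bfunP => x /=; rewrite mulrA indicE.
by case: (_ \in _); rewrite ?mulr1 ?mul0r.
Qed.

Lemma bip_bmul (u f g : bfun) : ip (bmul u f) g = ip f (bmul u g).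
Proof. by apply: eq_Rintegral => x _ /=; rewrite mulrCA mulrA. Qed.

Lemma iter_Tpb_ge0 n (f : bfun) : (forall x, 0 <= f x) ->
  forall x, 0 <= iter n (T \o pb) f x.
Proof.
move=> f0; elim: n => [//|n IHn] x; apply: Rintegral_ge0 => y _.
by rewrite /= mulr_ge0 ?bcompl_ge0.
Qed.

Lemma fret_ge0 n x : 0 <= fret n x.
Proof. by apply: iter_Tpb_ge0 => y; apply: Rintegral_ge0. Qed.

Lemma surv_ge0 n x : 0 <= surv n x.
Proof. exact: iter_Tpb_ge0. Qed.

Lemma survS n : surv n.+1 = surv n - fret n.
Proof.
have pb1 : pb one = one - a by apply: bfunP => x /=; rewrite mulr1.
elim: n => [|n IHn].
  rewrite -[surv 1]/(T (pb one)) -[fret 0]/(T a) -[surv 0]/one pb1.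
  by rewrite linearB; congr (_ - _); exact: bavg1.
by rewrite -[surv n.+2]/(T (pb (surv n.+1))) [in LHS]IHn !linearB.
Qed.

Lemma surv_le1 n x : surv n x <= 1.
Proof.
elim: n => [//|n IHn]; rewrite survS bfunB.
by rewrite (le_trans _ IHn)// gerBl fret_ge0.
Qed.

Lemma nincr_surv x : nonincreasing_seq (fun n => surv n x).
Proof.
by apply/nonincreasing_seqP => n; rewrite survS bfunB gerBl fret_ge0.
Qed.

Lemma surv_atom n x : A x -> surv n x = surv n x0.
Proof. by case: n => [//|n] Ax; exact: (T_atom Ax (pb (surv n))). Qed.

Lemma fret_atom n x : A x -> fret n x = fret n x0.
Proof.
case: n => [|n] Ax; first exact: (T_atom Ax a).
exact: (T_atom Ax (pb (fret n))).
Qed.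

Lemma surv_le_moment (x : X) (s : R) :
  (forall N, \sum_(n < N) kappa ^+ n.+1 * fret n x <= s) ->
  (fun n => surv n x) @ \oo --> 0 ->
  forall N, surv N x <= s * kappa ^- N.+1.
Proof.
apply: (@tail_le_moment _ _ s (surv^~ x) (fret^~ x)) => // n.
  exact: fret_ge0.
by rewrite survS.
Qed.

Let s n := surv n x0.

Let surv_le_S N : kappa ^+ N.+1 * s N <= S.
Proof.
apply: le_trans (moment N); rewrite lerDr sumr_ge0// => i _.
by rewrite mulr_ge0 ?fret_ge0 ?exprn_ge0 ?(ltW k0).
Qed.

Let S_ge0 : 0 <= S.
Proof. by apply: le_trans (surv_le_S 0); rewrite mulr_ge0 ?surv_ge0 ?exprn_ge0 ?(ltW k0). Qed.

Lemma cvg_surv_atom : (fun n => surv n x0) @ \oo --> 0.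
Proof.
have kc : (fun n => S * (kappa^-1 ^+ n.+1)) @ \oo --> S * 0.
  apply: cvgMr; rewrite (cvg_shiftS (fun n => kappa^-1 ^+ n)); apply: cvg_expr.
  by rewrite gtr0_norm ?invr_gt0// invf_lt1.
rewrite mulr0 in kc.
apply: squeeze_cvgr kc; [|exact: cvg_cst].
apply: nearW => n; rewrite surv_ge0/=.
by rewrite exprVn ler_pdivlMr ?exprn_gt0// mulrC surv_le_S.
Qed.

Lemma sum_surv_atom N :
  (kappa - 1) * \sum_(n < N) kappa ^+ n * surv n x0 <= S.
Proof.
(* Summation by parts, as [fret n = surv n - surv n.+1]. *)
have abel M : \sum_(n < M) kappa ^+ n.+1 * fret n x0 + kappa ^+ M * s M =
    1 + (kappa - 1) * \sum_(n < M) kappa ^+ n * s n.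
  elim: M => [|M IHM]; first by rewrite !big_ord0 mulr0 addr0 add0r mul1r.
  rewrite !big_ord_recr/= mulrDr addrA -IHM /s survS bfunB exprS; ring.
have := abel N; have := moment N; rewrite -/(s N) exprS.
have : kappa ^+ N * s N <= kappa * kappa ^+ N * s N.
  by rewrite -mulrA ler_peMl ?mulr_ge0 ?surv_ge0 ?exprn_ge0 ?(ltW k0)// ltW.
rewrite -/s; lra.
Qed.

Lemma bmul_bcompl_iter n f : pb (iter n (T \o pb) f) = iter n Q (pb f).
Proof.
by elim: n => [//|n IHn]; rewrite !iterS -IHn; congr pb; congr T; rewrite bmul_bcompl_idem.
Qed.

Lemma bip_Q f g : ip (Q f) g = ip f (Q g).
Proof. by rewrite /= bip_bmul bip_bavg// bip_bmul. Qed.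

Lemma bip_iterQ n f g : ip (iter n Q f) g = ip f (iter n Q g).
Proof.
by elim: n f g => [//|n IHn] f g; rewrite iterSr IHn bip_Q -iterS.
Qed.

Lemma bmul_bcompl1 : pb one = b.
Proof. by apply: bfunP => x /=; rewrite mulr1. Qed.

Lemma bmul_bcompl_bcompl : pb b = b.
Proof. by apply: bfunP => x /=; rewrite bcompl_idem. Qed.

Lemma iterQ_b n : iter n Q b = pb (surv n).
Proof. by rewrite bmul_bcompl_iter bmul_bcompl1. Qed.

Lemma bip_atom (f : bfun) c : (forall x, A x -> f x = c) -> ip a f = c * fine (pi A).
Proof.
move=> fc; rewrite -bip_bindic -(sipZr sip); apply: eq_Rintegral => x _.
rewrite -[RHS]/(\1_A x * (c * \1_A x)) /= indicE; have [xA|] := boolP (x \in A); last by rewrite !mul0r.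
by rewrite !mul1r fc ?mulr1//; exact: set_mem.
Qed.

(* Kac's formula: by self-adjointness, starting in equilibrium off [A] and
   entering [A] at time [n+1] has the probability of starting in equilibrium in
   [A] and staying out of it for that long. *)
Lemma bip_fret n : ip b (fret n) = s n.+1 * fine (pi A).
Proof.
rewrite -{1}bmul_bcompl_bcompl bip_bmul /fret bmul_bcompl_iter -bip_iterQ iterQ_b -bip_bmul bmul_bcompl_idem.
rewrite -bip_bavg// (sipC sip) -[bavg _ _]/(surv n.+1) (@bip_atom _ (s n.+1))//.
by move=> x; exact: surv_atom.
Qed.

(* The limit [w] of [surv n] satisfies [T w <= w] and vanishes at [x0], so
   [T^n w x0 = 0] for all [n], and irreducibility gives [w = 0] a.e. *)
Lemma ae_cvg_surv : {ae pi, forall x, (fun n => surv n x) @ \oo --> 0}.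
Proof.
have cvgs x : cvgn (fun n => surv n x).
  apply: nonincreasing_is_cvgn; first exact: nincr_surv.
  by exists 0 => _ [n _ <-]; exact: surv_ge0.
pose w0 x := limn (fun n => surv n x).
have mw0 : measurable_fun setT w0.
  apply: measurable_fun_cvg (fun x _ => cvgs x) => n; exact: measurable_bfun.
have w0_ge0 x : 0 <= w0 x by apply: limr_ge => //; apply: nearW => n; exact: surv_ge0.
have w0_le n x : w0 x <= surv n x.
  by apply: nonincreasing_cvgn_ge => //; exact: nincr_surv.
have bw : w0 \in @bmeas _ X R.
  apply: bmeasP => //; exists 1 => x; rewrite ger0_norm//.
  exact: le_trans (w0_le 0 x) _.
pose w : bfun := BFun bw.
have wA x : A x -> w x = 0.
  move=> Ax; apply: cvg_lim => //=; under eq_fun do rewrite (surv_atom _ Ax).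
  exact: cvg_surv_atom.
have Tw x : T w x <= w x.
  have TwS n : T w x <= surv n.+1 x.
    apply: (@le_bavg _ _ _ P w (pb (surv n))) => y.
    rewrite -[leRHS]/(b y * surv n y).
    have [Ay|Ay] := pselect (A y); first by rewrite [leLHS](wA _ Ay) mulr_ge0 ?bcompl_ge0 ?surv_ge0.
    by rewrite bcompl_notin// mul1r; exact: w0_le.
  apply: limr_ge => //; near=> n; have n0 : (0 < n)%N by near: n; exists 1.
  by rewrite -(prednK n0).
have iTw n x : iter n T w x <= w x.
  elim: n x => [//|n IHn] x; rewrite iterS.
  exact: le_trans (@le_bavg _ _ _ P _ w IHn x) (Tw x).
have w_null (e : R) : 0 < e -> {ae pi, forall x, w x <= e}.
  move=> e0; have mB : measurable [set x | e < w x].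
    have -> : [set x | e < w x] = setT `&` w @^-1` `]e, +oo[.
      by apply/seteqP; split => x /=; rewrite in_itv/= andbT => // -[].
    exact: measurable_bfun.
  exists [set x | e < w x]; split => //; last first.
    by move=> x /= /negP; rewrite -ltNge.
  apply/eqP; rewrite eq_le measure_ge0 andbT leNgt; apply/negP.
  move=> /(T_irr mB)[n]; apply/negP; rewrite -leNgt.
  (* By monotonicity [T^n] of this indicator at [x0] is at most
     [e^-1 * T^n w x0 <= e^-1 * w x0 = 0], against [T_irr]. *)
  have Bw x : bindic R mB x <= (e^-1 *: w) x.
    rewrite bfunZ /= indicE; have [/set_mem /= ex|_] := boolP (x \in _).
      by rewrite mulrC ler_pdivlMr// mul1r ltW.
    by rewrite mulr_ge0// invr_ge0 ltW.
  have : iter n T (bindic R mB) x0 <= (e^-1 *: iter n T w) x0.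
    elim: n (x0) => [//|n IHn] x; rewrite !iterS -linearZ.
    exact: le_bavg.
  move=> /le_trans; apply; rewrite bfunZ pmulr_rle0 ?invr_gt0//.
  by rewrite -(wA _ A_x0).
have wn n : {ae pi, forall x, w x <= n.+1%:R^-1}.
  by apply: w_null; rewrite invr_gt0.
have := ae_foralln wn; apply: filterS => x wx; have wx0 : w x = 0; last by rewrite -wx0; exact: cvgs.
apply/eqP; rewrite eq_le w0_ge0 andbT leNgt; apply/negP => /ltr_add_invr[n].
by rewrite add0r ltNge wx.
Unshelve. all: by end_near.
Qed.

Lemma cvg_bip_surv : (fun n => ip b (surv n)) @ \oo --> 0.
Proof.
have m1 (f : bfun) : measurable_fun setT (EFin \o f).
  by apply/measurable_EFinP; exact: measurable_bfun.
have [|||||_ _] := @dominated_convergence _ _ _ pi setT measurableT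
  (fun n => EFin \o bmul b (surv n)) (cst 0%E) (EFin \o one).
- by [].
- by [].
- apply: filterS ae_cvg_surv => x svx _; apply: cvg_EFin; first exact: nearW.
  by rewrite -(mulr0 (b x)); apply: cvgMr.
- by apply: integrable_bfun; exact: prob_lty.
- apply: nearW => x n _; rewrite lee_fin ger0_norm ?mulr_ge0 ?bcompl_ge0 ?surv_ge0//.
  by rewrite mulr_ile1 ?bcompl_ge0 ?surv_ge0 ?bcompl_le1 ?surv_le1.
rewrite integral0 => /fine_cvgP[_]; apply: cvg_trans.
by apply: near_eq_cvg; apply: nearW => n.
Qed.

(** By Kac's formula the exponential moment in equilibrium off the atom is [pi A] times a weighted
    sum of survival probabilities from the atom, and summation by parts bounds that sum by
    [S / (kappa - 1)]. *)
Definition decay_const := S / (kappa - 1) * fine (pi A).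

Let decay_const_ge0 : 0 <= decay_const.
Proof. by rewrite mulr_ge0 ?divr_ge0 ?subr_ge0 ?(ltW kappa_gt1)// ltW. Qed.

Lemma sum_bip_fret N :
  \sum_(n < N) kappa ^+ n.+1 * ip b (fret n) <= decay_const.
Proof.
under eq_bigr do rewrite bip_fret mulrA.
rewrite -mulr_suml ler_pM2r// ler_pdivlMr ?subr_gt0// mulrC.
apply: le_trans (sum_surv_atom N.+1); rewrite ler_pM2l ?subr_gt0//.
by rewrite big_ord_recl lerDr mulr_ge0 ?surv_ge0.
Qed.

Lemma bip_surv_le n : ip b (surv n) <= decay_const * kappa ^- n.
Proof.
apply: le_trans (_ : decay_const * kappa ^- n.+1 <= _); last first.
  rewrite ler_wpM2l// lef_pV2 ?posrE ?exprn_gt0//.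
  by rewrite exprS ler_peMl ?exprn_ge0 ?(ltW k0)// ltW.
apply: (@tail_le_moment _ kappa _ (fun n => ip b (surv n))
  (fun n => ip b (fret n))) => //.
- by move=> m; rewrite bip_fret mulr_ge0 ?surv_ge0// ltW.
- by move=> m; rewrite survS (sipBr sip).
- exact: sum_bip_fret.
- exact: cvg_bip_surv.
Qed.

Lemma le_bip (u v : bfun) : (forall x, `|u x| <= v x) -> ip u u <= ip v v.
Proof.
move=> uv; apply: le_Rintegral_bfun; first exact: prob_lty.
move=> x /=; have := uv x; have := normr_ge0 (u x) => u0 uvx.
by rewrite -!expr2 -(real_normK (num_real (u x))) ler_pXn2r ?nnegrE// (le_trans u0).
Qed.

Lemma norm_bavg_le (f g : bfun) : (forall x, `|f x| <= g x) ->
  forall x, `|T f x| <= T g x.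
Proof.
move=> fg x; rewrite ler_norml; apply/andP; split.
  have -> : - T g x = T (- g) x by rewrite linearN.
  by apply: le_bavg => y; have := fg y; rewrite ler_norml => /andP[].
by apply: le_bavg => y; have := fg y; rewrite ler_norml => /andP[].
Qed.

Lemma sip_norm_le (c : R) (f g : bfun) : 0 <= c ->
  ip f f <= c ^+ 2 * ip g g -> `[f] <= c * `[g].
Proof.
move=> c0 fg; rewrite -(@ler_pXn2r _ 2)// ?nnegrE ?mulr_ge0 ?sip_norm_ge0//.
by rewrite exprMn !(sqr_sip_norm sip).
Qed.

(** Averaging preserves a pointwise bound on [|f|], so the squared norms of the iterates stay
    bounded: growth rate [1]. *)
Lemma sip_norm_bavg_le f : `[T f] <= `[f].
Proof.
rewrite -[leRHS]mul1r; apply: sip_norm_le => //; rewrite expr1n.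
have [M M0 fM] := bfun_bounded f.
apply: (selfadjoint_le_growth sip (C := ip (M *: one) (M *: one))) => //.
  by move=> g h; exact: bip_bavg.
move=> n; rewrite expr1n mulr1; apply: le_bip.
elim: n => [|n IHn] x; first by rewrite bfunZ mulr1.
have T1 : T (M *: one) = M *: one by rewrite linearZ; congr (_ *: _); exact: bavg1.
by rewrite iterS (le_trans (norm_bavg_le IHn x))// T1.
Qed.

Lemma sip_norm_Q_le f : `[Q f] <= kappa^-1 * `[f].
Proof.
apply: sip_norm_le; first by rewrite invr_ge0 ltW.
(* For [pb f] the pointwise bound [M * b] holds, and [Q] preserves such comparisons, so the iterates
   on [b] dominate. *)
have -> : Q f = Q (pb f) by rewrite /= bmul_bcompl_idem.
apply: (@le_trans _ _ (kappa^-1 ^+ 2 * ip (pb f) (pb f))); last first.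
  rewrite ler_wpM2l ?exprn_ge0 ?invr_ge0 ?(ltW k0)// bip_bmul bmul_bcompl_idem.
  apply: le_Rintegral_bfun; first exact: prob_lty.
  move=> x /=; rewrite mulrCA -[leRHS]mul1r ler_wpM2r ?bcompl_le1//.
  by rewrite -expr2 sqr_ge0.
have [M M0 fM] := bfun_bounded f.
apply: (selfadjoint_le_growth sip (C := M ^+ 2 * decay_const)).
- exact: bip_Q.
- by rewrite exprn_gt0// invr_gt0.
move=> n; apply: (@le_trans _ _ (ip (M *: iter n Q b) (M *: iter n Q b))).
  apply: le_bip; elim: n => [|n IHn] x.
    rewrite bfunZ /= normrM ger0_norm ?bcompl_ge0// mulrC.
    by rewrite ler_wpM2r ?bcompl_ge0.
  have pbn (u v : bfun) : (forall y, `|u y| <= v y) ->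
      forall y, `|pb u y| <= pb v y.
    by move=> uv y /=; rewrite normrM ger0_norm ?ler_wpM2l ?bcompl_ge0.
  have -> : M *: iter n.+1 Q b = Q (M *: iter n Q b) by rewrite !linearZ.
  by apply: (pbn); apply: norm_bavg_le; apply: pbn.
rewrite (sipZl sip) (sipZr sip) mulrA -expr2 -mulrA ler_wpM2l ?sqr_ge0//.
(* [|Q^n b|^2 = <b, Q^(2n) b>] is the equilibrium survival up to time [2n], of order
   [kappa^(-2n)]. *)
rewrite bip_iterQ -iterD iterQ_b -bip_bmul bmul_bcompl_bcompl (le_trans (bip_surv_le _))//.
by rewrite -exprM exprVn mul2n -addnn.
Qed.

Lemma bfun_sum n (F : 'I_n -> bfun) x : (\sum_(i < n) F i) x = \sum_(i < n) F i x.
Proof.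
elim: n F => [|n IHn] F; first by rewrite !big_ord0.
by rewrite !big_ord_recr bfunD IHn.
Qed.

(** The terms of even index are nonnegative and are dropped. As [fret n] belongs to time [n.+1], the
    odd indices that are kept are the even return times. *)
Lemma signed_sum_ge (u : nat -> R) M : (forall n, 0 <= u n) ->
  - \sum_(n < M./2) u (2 * n).+1 <= \sum_(n < M) (-1) ^+ n * u n.
Proof.
move=> u0; elim: M => [|M IHM]; first by rewrite !big_ord0 oppr0.
rewrite big_ord_recr/= uphalf_half -signr_odd.
have [oM|oM] := boolP (odd M); last by rewrite mul1r (le_trans IHM)// lerDl.
rewrite add1n big_ord_recr/= opprD expr1 mulN1r lerD//.
have -> // : (2 * M./2).+1 = M.
by rewrite mul2n -[RHS]odd_double_half oM.
Qed.

(** Identifies the scalar [nu w] of the abstract resolvent argument: each further [Q] before the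
    final average delays the return to the atom by one step. *)
Lemma avg_test_vector (l : R) N :
  T (a + \sum_(i < N) l ^- i.+1 *: iter i Q (pb (T a))) x0 =
  \sum_(i < N.+1) l ^- i * fret i x0.
Proof.
rewrite linearD bfunD linear_sum bfun_sum big_ord_recl expr0 invr1 mul1r.
congr (_ + _); apply: eq_bigr => i _; rewrite linearZ bfunZ -bmul_bcompl_iter.
by congr (_ * _).
Qed.

(** * The norm bound on functions of mean zero *)

Context (r : R).
Hypothesis r_ge1 : 1 <= r.
Hypothesis r_le : r <= kappa.
Hypothesis even_lt1 : forall z : R, 0 <= z -> z < r -> exists2 eta : R, 0 < eta &
  forall N, \sum_(n < N) z ^+ (2 * n.+1) * fret (2 * n).+1 x0 <= 1 - eta.

(* With [F] the generating function of the return times to the atom, the sum is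
   [c * F(1/c)] up to truncation. For [c > 0], [F(1/c) > F(1) = 1]; for [c < 0],
   only the even times contribute positively to [F(1/c)]. *)
Lemma test_vector_far (c : R) : r^-1 < `|c| -> `|c| <= 1 -> c != 1 ->
  exists2 eta : R, 0 < eta & exists N0, forall N, (N0 <= N)%N ->
    eta <= `|\sum_(i < N.+1) c ^- i * fret i x0 - c|.
Proof.
move=> rc c1 cn1; have r0 : 0 < r by exact: lt_le_trans r_ge1.
have c0 : 0 < `|c| by rewrite (lt_trans _ rc)// invr_gt0.
have cN0 : c != 0 by rewrite -normr_gt0.
pose z := `|c|^-1; have z0 : 0 < z by rewrite invr_gt0.
have zr : z < r by rewrite -[r]invrK ltf_pV2 ?posrE ?invr_gt0.
have factor N : \sum_(i < N.+1) c ^- i * fret i x0 - c =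
    c * (\sum_(i < N.+1) c ^- i.+1 * fret i x0 - 1).
  rewrite mulrBr mulr1 mulr_sumr; congr (_ - _); apply: eq_bigr => i _.
  by rewrite mulrA exprS invfM mulrA mulfV// mul1r.
move: cN0; rewrite neq_lt => /orP[cn|cp].
  (* For [c < 0], [c ^- i.+1 = - (-1) ^ i * z ^ i.+1], so the partial sums of [F(1/c) - 1] are at
     most [- eta]. *)
  have [eta eta0 etaP] := even_lt1 (ltW z0) zr.
  exists (`|c| * eta); first by rewrite mulr_gt0.
  exists 0 => N _; rewrite factor normrM ler_wpM2l//.
  have -> : \sum_(i < N.+1) c ^- i.+1 * fret i x0 =
      - \sum_(i < N.+1) (-1) ^+ i * (z ^+ i.+1 * fret i x0).
    rewrite -sumrN; apply: eq_bigr => i _.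
    rewrite mulrA -mulNr; congr (_ * _).
    have zE : z = - c^-1 by rewrite /z ltr0_norm// invrN.
    rewrite zE (exprNn c^-1) -exprVn mulrA -mulNr -exprD addnS [(-1) ^+ _.+1]exprS mulN1r opprK.
    by rewrite addnn -signr_odd odd_double mul1r.
  rewrite -opprD normrN (le_trans _ (ler_norm _))// addrC.
  have := @signed_sum_ge (fun i => z ^+ i.+1 * fret i x0) N.+1.
  move=> /(_ (fun n => mulr_ge0 (exprn_ge0 n.+1 (ltW z0)) (fret_ge0 n x0))).
  have := etaP (N.+1)./2.
  under eq_bigr do rewrite mulnS add2n.
  lra.
have z1 : 1 < z.
  rewrite invf_gt1// lt_neqAle c1 andbT.
  by rewrite gtr0_norm.
have cE : c = `|c| by rewrite gtr0_norm.
(* Since [z > 1], the partial sums of [F(1/c)] are at least [z] times those of [F(1)], which are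
   [1 - surv N x0] and tend to [1]. Halfway between [1] and [z] is reached from some [N0] on. *)
have : (fun N => z * (1 - surv N x0)) @ \oo --> z * (1 - 0).
  by apply: cvgMr; apply: cvgB; [exact: cvg_cst|exact: cvg_surv_atom].
rewrite subr0 mulr1 => /cvgr_ge /(_ ((1 + z) / 2)); case; first by lra.
move=> N0 _ hN0; exists (`|c| * ((z - 1) / 2)); first by rewrite mulr_gt0// divr_gt0// subr_gt0.
exists N0 => N NN0; rewrite factor normrM ler_wpM2l//.
rewrite (le_trans _ (ler_norm _))//.
suff : z * (1 - surv N.+1 x0) <= \sum_(i < N.+1) c ^- i.+1 * fret i x0.
  by have := hN0 N.+1 (leqW NN0); rewrite /=; lra.
have -> : 1 - surv N.+1 x0 = \sum_(i < N.+1) fret i x0.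
  elim: N.+1 => [|M IHM]; first by rewrite big_ord0 subrr.
  by rewrite big_ord_recr -IHM survS bfunB opprB addrCA addrC.
rewrite mulr_sumr; apply: ler_sum => i _; rewrite ler_wpM2r ?fret_ge0//.
by rewrite cE -exprVn -/z exprS ler_peMr ?(ltW z0)// exprn_ege1// ltW.
Qed.

Lemma sip_norm_bavg_mean0 f : ip f one = 0 -> `[T f] <= r^-1 * `[f].
Proof.
have r0 : 0 < r by exact: lt_le_trans r_ge1.
have TQ : forall f, (pb \o T \o pb : {linear bfun -> bfun}) f = pb (T (pb f)) by [].
have T_sa g h : ip (T g) h = ip g (T h) by exact: bip_bavg.
have pa_a : pa a = a.
  by apply: bfunP => x /=; rewrite indicE; case: (_ \in _); rewrite ?mulr1 ?mulr0.
have paT g : pa (T g) = T g x0 *: a.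
  apply: bfunP => x; rewrite bfunZ -[LHS]/(\1_A x * T g x) -[a x]/(\1_A x) indicE.
  have [/set_mem Ax|_] := boolP (x \in A); last by rewrite mul0r mulr0.
  by rewrite mul1r mulr1 T_atom.
have a_gt0 : 0 < ip a a by rewrite bip_bindic.
have ki0 : 0 < kappa^-1 by rewrite invr_gt0.
have ki1 : kappa^-1 < 1 by rewrite invf_lt1.
have below := atom_bounded_below sip bmul_bcomplE TQ T_sa sip_norm_bavg_le
  (bip_bmul a) bmul_bindic_idem pa_a paT a_gt0 ki0 sip_norm_Q_le.
have below1 := atom_bounded_below1 sip bmul_bcomplE TQ sip_norm_bavg_le
  (bip_bmul a) bmul_bindic_idem pa_a paT a_gt0 sip_norm_Q_le ki1.
apply: (selfadjoint_le_bounded_below sip (D := [set f | ip f one = 0])) => //.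
- move=> c g /= g1; rewrite (sipDl sip) (sipZl sip) g1 mulr0 addr0.
  by rewrite T_sa bavg1.
- by rewrite invr_ge0 ltW.
- by move=> g _; exact: sip_norm_bavg_le.
move=> c rc c1; have [->|cn1] := eqVneq c 1.
  apply: (below1 one); first exact: bavg1.
  by apply: bfunP => x /=; rewrite mulr1.
have [eta eta0 [N0 etaP]] := test_vector_far rc c1 cn1.
have kc : kappa^-1 < `|c|.
  by rewrite (le_lt_trans _ rc)// lef_pV2 ?posrE.
have [|K K0 KP] := below c eta N0 kc eta0.
  by move=> N NN0; rewrite avg_test_vector; exact: etaP.
by exists K => // g _; exact: KP.
Qed.

(** * Convergence from the atom and from almost every point *)

Let r_gt0 : 0 < r. Proof. exact: lt_le_trans r_ge1. Qed.

Lemma iter_avg_linear n c f g : iter n T (c *: f + g) = c *: iter n T f + iter n T g.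
Proof. by elim: n => [//|n IHn]; rewrite !iterS IHn linearP. Qed.

Lemma iter_avg_center n f c : iter n T (f - c *: one) = iter n T f - c *: one.
Proof.
rewrite -scaleNr addrC iter_avg_linear addrC; congr (_ + _ *: _).
by elim: n => [//|n IHn]; rewrite iterS IHn; exact: bavg1.
Qed.

Lemma sip_norm_iter_mean0 n f : ip f one = 0 ->
  ip (iter n T f) one = 0 /\ `[iter n T f] <= r ^- n * `[f].
Proof.
move=> f1; elim: n => [|n [IH1 IH2]]; first by rewrite expr0 invr1 mul1r.
split; first by rewrite iterS bip_bavg// bavg1.
rewrite iterS (le_trans (sip_norm_bavg_mean0 IH1))//.
by rewrite exprS invfM -mulrA ler_wpM2l// invr_ge0 ltW.
Qed.

Lemma bip_one_one : ip one one = 1.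
Proof.
by rewrite bip1 Rintegral_bone; exact: (congr1 fine (probability_setT pi)).
Qed.

(** At least one step is taken, because [f] itself need not be constant on the atom. *)
Lemma iter_avg_atom_le n (f : bfun) : (forall y, `|f y| <= 1) ->
  `|iter n.+1 T f x0 - ip f one| <=
  Num.sqrt ((fine (pi A))^-1 - 1) * r ^- n.+1.
Proof.
move=> f1; set m := ip f one; pose f0 := f - m *: one.
(* [h] is the centred density of [pi] conditioned on [A]; its squared norm [1 / al - 1] is the
   origin of the constant, while [|f0| <= |f| <= 1] adds no factor. *)
pose al := fine (pi A); pose h := al^-1 *: a - one.
have al0 : al != 0 by rewrite gt_eqF.
have f0_mean : ip f0 one = 0.
  by rewrite /f0 (sipBl sip) (sipZl sip) bip_one_one mulr1 subrr.
have [It0 Itle] := sip_norm_iter_mean0 n.+1 f0_mean.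
have -> : iter n.+1 T f x0 - m = ip h (iter n.+1 T f0).
  rewrite /h (sipBl sip) (sipZl sip) (sipC sip one) It0 subr0.
  rewrite (@bip_atom _ (iter n.+1 T f0 x0)); last first.
    by move=> x Ax; exact: (T_atom Ax (iter n T f0)).
  rewrite mulrCA mulVf// mulr1 /f0 iter_avg_center bfunB bfunZ.
  by rewrite -[one x0]/(1 : R) mulr1.
rewrite (le_trans (sip_le_norm sip _ _))// ler_pM ?sip_norm_ge0//.
  rewrite /sip_norm ler_wsqrtr// /h.
  rewrite (sipBl sip) !(sipBr sip) !(sipZl sip, sipZr sip) bip_one_one bip_bindic.
  rewrite (sipC sip one) bip1.
  have -> : \int[pi]_x a x = al by rewrite /Rintegral integral_indic// setIT.
  by rewrite -/al mulVf// mulr1 subrr subr0.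
rewrite (le_trans Itle)// ler_piMr ?invr_ge0 ?exprn_ge0 ?(ltW r_gt0)//.
rewrite -sqrtr1 /sip_norm ler_wsqrtr//.
rewrite /f0 (sipBl sip) !(sipBr sip) !(sipZl sip, sipZr sip) bip_one_one.
rewrite (sipC sip one f) -/m mulr1 subrr subr0.
have : ip f f <= 1 by rewrite -bip_one_one; apply: le_bip => x; exact: f1.
have := sqr_ge0 m; rewrite expr2; lra.
Qed.

(** Entering at time [k.+1 <= n] leaves [n - k >= 1] steps from the atom. An entrance at the last
    time [n.+1] belongs to the final term, again because [f] is not constant on the atom. *)
Lemma iter_avg_first_entrance n f : iter n.+1 T f =
  \sum_(k < n) iter (n - k) T f x0 *: fret k + iter n (T \o pb) (T f).
Proof.
elim: n => [|n IHn]; first by rewrite big_ord0 add0r.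
have h_atom : pa (iter n.+1 T f) = iter n.+1 T f x0 *: a.
  apply: bfunP => x; rewrite bfunZ -[LHS]/(\1_A x * iter n.+1 T f x) -[a x]/(\1_A x) indicE.
  have [/set_mem Ax|_] := boolP (x \in A); last by rewrite mul0r mulr0.
  by rewrite mul1r mulr1; exact: (T_atom Ax (iter n T f)).
have -> : iter n.+2 T f =
    iter n.+1 T f x0 *: fret 0 + T (pb (iter n.+1 T f)).
  by rewrite bmul_bcomplE h_atom linearB linearZ addrC subrK.
rewrite big_ord_recl subn0 -addrA; congr (_ + _).
rewrite {1}IHn !linearD !linear_sum; congr (_ + _).
by apply: eq_bigr => k _; rewrite !linearZ.
Qed.

Lemma iter_avg_le x (s' : R) :
  (forall N, \sum_(n < N) kappa ^+ n.+1 * fret n x <= s') ->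
  (fun n => surv n x) @ \oo --> 0 ->
  exists C : R, forall n (f : bfun), (forall y, `|f y| <= 1) ->
    `|iter n T f x - ip f one| <= C * r ^- n.
Proof.
move=> frets survs; have surv_le := surv_le_moment frets survs.
set K := Num.sqrt ((fine (pi A))^-1 - 1).
have K0 : 0 <= K by exact: sqrtr_ge0.
have s0 : 0 <= s' by have := frets 0; rewrite big_ord0.
have m_le (f : bfun) : (forall y, `|f y| <= 1) -> `|ip f one| <= 1.
  move=> f1; rewrite bip1.
  have := norm_Rintegral_bfun_le (prob_lty pi) f1.
  by have -> : fine (pi setT) = 1 := congr1 fine (probability_setT pi); rewrite mulr1.
(* [K * s'] comes from the paths that have entered the atom, whose weights [r ^ k.+1] are absorbed
   by [kappa ^ k.+1]; [2 * s'] from those that have not, as [|f0| <= 2]; the last [2] covers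
   [n = 0]. *)
exists ((K + 2) * s' + 2) => -[|n] f f1.
  rewrite expr0 invr1 mulr1 (le_trans (ler_normB _ _))//.
  have := f1 x; have := m_le _ f1.
  have : 0 <= (K + 2) * s' by rewrite mulr_ge0// addr_ge0.
  rewrite /=; lra.
pose f0 := f - ip f one *: one.
have f02 y : `|f0 y| <= (2 *: one) y.
  rewrite /f0 bfunB !bfunZ !mulr1 (le_trans (ler_normB _ _))//.
  by have := f1 y; have := m_le _ f1; lra.
have -> : iter n.+1 T f x - ip f one = iter n.+1 T f0 x.
  by rewrite /f0 iter_avg_center bfunB bfunZ mulr1.
have f0_atom j : `|iter j.+1 T f0 x0| <= K * r ^- j.+1.
  rewrite /f0 iter_avg_center bfunB bfunZ mulr1.
  exact: iter_avg_atom_le.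
have rem : `|iter n (T \o pb) (T f0) x| <= 2 * surv n x.
  have : forall y, `|iter n (T \o pb) (T f0) y| <= (2 *: surv n) y.
    elim: n => [|n IHn] y.
      apply: (le_trans (norm_bavg_le f02 y)).
      have -> // : T (2 *: one) = 2 *: one.
      by rewrite linearZ; congr (_ *: _); exact: bavg1.
    have -> : 2 *: surv n.+1 = T (pb (2 *: surv n)) by rewrite !linearZ.
    apply: norm_bavg_le => z /=.
    by rewrite normrM ger0_norm ?bcompl_ge0// ler_wpM2l ?bcompl_ge0.
  by move=> /(_ x).
rewrite iter_avg_first_entrance bfunD bfun_sum (le_trans (ler_normD _ _))//.
apply: (@le_trans _ _ (K * s' * r ^- n.+1 + 2 * (s' * r ^- n.+1))).
  apply: lerD.
    rewrite (le_trans (ler_norm_sum _ _ _))//.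
    apply: (@le_trans _ _ (\sum_(k < n) K * r ^- n.+1 * (kappa ^+ k.+1 * fret k x))).
      apply: ler_sum => k _; rewrite bfunZ normrM (ger0_norm (fret_ge0 _ _)) mulrA.
      rewrite ler_wpM2r ?fret_ge0//.
      have nk : (n - k)%N = (n - k).-1.+1 by rewrite prednK// subn_gt0.
      rewrite {1}nk (le_trans (f0_atom _))// -nk -mulrA ler_wpM2l//.
      rewrite ler_pdivlMl ?exprn_gt0//.
      have -> : r ^+ n.+1 = r ^+ k.+1 * r ^+ (n - k).
        by rewrite -exprD addSn subnKC// ltnW.
      by rewrite mulfK ?expf_neq0 ?gt_eqF// lerXn2r// nnegrE ltW.
    rewrite -mulr_sumr mulrAC ler_wpM2r ?invr_ge0 ?exprn_ge0 ?(ltW r_gt0)//.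
    by rewrite ler_wpM2l.
  apply: (le_trans rem); rewrite ler_wpM2l// (le_trans (surv_le n))//.
  rewrite ler_wpM2l// lef_pV2 ?posrE ?exprn_gt0//.
  by rewrite lerXn2r// nnegrE ltW.
have : 0 <= r ^- n.+1 by rewrite invr_ge0 exprn_ge0 ?(ltW r_gt0).
set t := r ^- _; nra.
Qed.

(** The bound [S] concerns only starts in the atom. Off it the moment has a [pi]-integral of at most
    [decay_const], hence is finite almost everywhere. *)
Lemma ae_moment : {ae pi, forall x, exists s' : R,
  forall N, \sum_(n < N) kappa ^+ n.+1 * fret n x <= s'}.
Proof.
pose g n : bfun := kappa ^+ n.+1 *: bmul b (fret n).
have g0 n x : (0 <= (g n x)%:E)%E.
  rewrite lee_fin /g bfunZ mulr_ge0 ?exprn_ge0 ?(ltW k0)//.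
  by rewrite mulr_ge0 ?bcompl_ge0 ?fret_ge0.
have mg n : measurable_fun setT (fun x => (g n x)%:E).
  by apply/measurable_EFinP; exact: measurable_bfun.
pose G x := (\sum_(n <oo) (g n x)%:E)%E.
have mG : measurable_fun setT G by exact: ge0_emeasurable_sum.
have G0 x : (0 <= G x)%E by exact: nneseries_ge0.
have intG : pi.-integrable setT G.
  apply/integrableP; split => //.
  under eq_integral do rewrite gee0_abs//.
  rewrite integral_nneseries//; apply: (@le_lt_trans _ _ decay_const%:E); last first.
    by rewrite ltry.
  apply: lime_le; first by apply: is_cvg_nneseries => n _ _; exact: integral_ge0.
  apply: nearW => N; rewrite big_mkord.
  rewrite (eq_bigr (fun n : 'I_N => (kappa ^+ n.+1 * ip b (fret n))%:E)).
    by rewrite sumEFin lee_fin sum_bip_fret.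
  move=> n _; rewrite integral_bfun; last exact: prob_lty.
  by congr EFin; rewrite -(bip1 pi (g n)) /g (sipZl sip) bip1.
have := integrable_ae measurableT intG; apply: filterS => x /(_ Logic.I) Gx.
have [Ax|Ax] := pselect (A x).
  exists S => N; under eq_bigr do rewrite (fret_atom _ Ax).
  apply: le_trans (moment N); rewrite lerDl mulr_ge0 ?surv_ge0//.
  by rewrite exprn_ge0 ?(ltW k0).
exists (fine (G x)) => N; rewrite -lee_fin fineK//.
rewrite -sumEFin.
have -> : (\sum_(n < N) (kappa ^+ n.+1 * fret n x)%:E =
    \sum_(0 <= n < N) (g n x)%:E)%E.
  rewrite big_mkord; apply: eq_bigr => n _; congr EFin.
  by rewrite /g bfunZ -[bmul _ _ _]/(b x * fret n x) bcompl_notin// mul1r.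
by apply: nneseries_lim_ge => *; exact: g0.
Qed.

End reversible_atom.

(** * Square-integrable functions *)

Section L2_norm.
Context d (X : measurableType d) (R : realType) (mu : probability X R).
Implicit Types (f g h : X -> R) (c : R).
Local Notation N2 f := (Lnorm mu 2%:E (fun x => (f x)%:E)).

Lemma poweR_Lnorm2 f : (N2 f `^ 2 = \int[mu]_x ((f x) ^+ 2)%:E)%E.
Proof.
rewrite poweR_Lnorm//; apply: eq_integral => x _.
by rewrite abse_EFin poweR_EFin powR_mulrn// real_normK ?num_real.
Qed.

Lemma Lnorm2E f : (N2 f = (\int[mu]_x ((f x) ^+ 2)%:E) `^ 2^-1)%E.
Proof. by rewrite -poweR_Lnorm2 -poweRrM mulfV// poweRe1// Lnorm_ge0. Qed.

Lemma Lnorm2_le f c : 0 <= c ->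
  (N2 f <= c%:E)%E = (\int[mu]_x ((f x) ^+ 2)%:E <= (c ^+ 2)%:E)%E.
Proof.
move=> c0; apply/idP/idP => [fc|fc].
  rewrite -poweR_Lnorm2.
  have -> : ((c ^+ 2)%:E = c%:E `^ 2)%E by rewrite poweR_EFin powR_mulrn.
  by apply: gt0_ler_poweR => //; rewrite in_itv/= ?leey ?andbT ?Lnorm_ge0 ?lee_fin.
rewrite Lnorm2E.
have -> : (c%:E = (c ^+ 2)%:E `^ 2^-1)%E.
  by rewrite poweR_EFin -powR_mulrn// -powRrM mulfV// powRr1.
apply: gt0_ler_poweR => //; rewrite in_itv/= ?leey ?andbT ?lee_fin ?sqr_ge0//.
by apply: integral_ge0 => x _; rewrite lee_fin sqr_ge0.
Qed.

Lemma Lnorm2_fin f : (N2 f < +oo)%E -> exists2 c, 0 <= c & N2 f = c%:E.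
Proof.
move=> foo; exists (fine (N2 f)); first by rewrite fine_ge0// Lnorm_ge0.
by rewrite fineK// ge0_fin_numE// Lnorm_ge0.
Qed.

Lemma Lnorm2_mono_ae f g : measurable_fun setT f -> measurable_fun setT g ->
  {ae mu, forall x, `|f x| <= `|g x|} -> (N2 f <= N2 g)%E.
Proof.
move=> mf mg fg; rewrite !Lnorm2E; apply: gt0_ler_poweR => //.
- rewrite in_itv/= leey andbT; apply: integral_ge0 => x _.
  by rewrite lee_fin sqr_ge0.
- rewrite in_itv/= leey andbT; apply: integral_ge0 => x _.
  by rewrite lee_fin sqr_ge0.
apply: ae_ge0_le_integral => //.
- by move=> x _; rewrite lee_fin sqr_ge0.
- by apply/measurable_EFinP; exact: measurable_funX.
- by move=> x _; rewrite lee_fin sqr_ge0.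
- by apply/measurable_EFinP; exact: measurable_funX.
apply: filterS fg => x fgx _; rewrite lee_fin.
by rewrite -[leLHS]real_normK ?num_real// -[leRHS]real_normK ?num_real// ler_pXn2r ?nnegrE.
Qed.

Lemma Lnorm2_mono f g : measurable_fun setT f -> measurable_fun setT g ->
  (forall x, `|f x| <= `|g x|) -> (N2 f <= N2 g)%E.
Proof. by move=> mf mg fg; apply: Lnorm2_mono_ae => //; exact: aeW. Qed.

Lemma Lnorm2D_le f g c c' : measurable_fun setT f -> measurable_fun setT g ->
  (N2 f <= c%:E)%E -> (N2 g <= c'%:E)%E ->
  (N2 (fun x => f x + g x) <= (c + c')%:E)%E.
Proof.
move=> mf mg fc gc; have h12 : (1 : R) <= 2 by rewrite ler1n.
rewrite [leRHS]EFinD; exact: le_trans (minkowski_EFin mu mf mg h12) (leeD fc gc).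
Qed.

Lemma Lnorm2Z_le k f c : measurable_fun setT f -> 0 <= c ->
  (N2 f <= c%:E)%E -> (N2 (fun x => k * f x) <= (`|k| * c)%:E)%E.
Proof.
move=> mf c0; rewrite !Lnorm2_le ?mulr_ge0//.
under [in X in _ -> X]eq_integral do rewrite exprMn EFinM.
rewrite ge0_integralZl_EFin ?sqr_ge0//.
- move=> fc; rewrite exprMn real_normK ?num_real// [leRHS]EFinM.
  by rewrite lee_wpmul2l// lee_fin sqr_ge0.
- by move=> x _; rewrite lee_fin sqr_ge0.
- by apply/measurable_EFinP; exact: measurable_funX.
Qed.

(** Both the extension from bounded functions to [L^2] and the summation of series in [L^2] pass to
    the limit through this semicontinuity. *)
Lemma Lnorm2_fatou (f_ : nat -> X -> R) f c : 0 <= c ->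
  (forall n, measurable_fun setT (f_ n)) -> measurable_fun setT f ->
  {ae mu, forall x, (fun n => f_ n x) @ \oo --> f x} ->
  (\forall n \near \oo, (N2 (f_ n) <= c%:E)%E) -> (N2 f <= c%:E)%E.
Proof.
move=> c0 mf_ mf f_f f_c; rewrite Lnorm2_le//.
have m2 (h : X -> R) : measurable_fun setT h ->
    measurable_fun setT (fun x => ((h x) ^+ 2)%:E).
  by move=> mh; apply/measurable_EFinP; exact: measurable_funX.
have ge2 (h : X -> R) x : (0 <= ((h x) ^+ 2)%:E)%E by rewrite lee_fin sqr_ge0.
apply: (@le_trans _ _ (\int[mu]_x limn_einf (fun n => ((f_ n x) ^+ 2)%:E))%E).
  apply: ae_ge0_le_integral => //.
  - exact: (m2 f mf).
  - move=> x _; rewrite limn_einf_lim; apply: lime_ge.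
      exact: is_cvg_einfs.
    by apply: nearW => n; apply: le_ereal_inf_tmp => _ [m /= nm <-].
  - apply: (@emeasurable_fun_cvg _ _ _ _
      (fun n x => einfs (fun n => ((f_ n x) ^+ 2)%:E) n)) => [n|x _].
      by apply: measurable_fun_einfs => m; exact: (m2 _ (mf_ m)).
    by rewrite limn_einf_lim; exact: is_cvg_einfs.
  - apply: filterS f_f => x f_fx _.
    have fc : (fun n => ((f_ n x) ^+ 2)%:E) @ \oo --> ((f x) ^+ 2)%:E.
      apply: cvg_EFin; first exact: nearW.
      by rewrite expr2; under eq_fun do rewrite expr2; exact: cvgM.
    rewrite is_cvg_limn_einfE; last by apply/cvg_ex; eexists; exact: fc.
    by rewrite (cvg_lim _ fc).
apply: (le_trans (fatou mu measurableT (fun n => m2 _ (mf_ n)) (fun n x _ => ge2 (f_ n) x))).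
rewrite limn_einf_lim; apply: lime_le; first exact: is_cvg_einfs.
have [N _ NP] := f_c; apply: nearW => n.
apply: (@le_trans _ _ (\int[mu]_x ((f_ (maxn n N) x) ^+ 2)%:E)%E).
  by apply: ereal_inf_lbound; exists (maxn n N) => //=; rewrite leq_maxl.
by rewrite -Lnorm2_le//; apply: NP; rewrite /= leq_maxr.
Qed.

Lemma Lnorm2_int_abs f c : measurable_fun setT f -> (N2 f <= c%:E)%E ->
  (\int[mu]_x `|(f x)%:E| <= c%:E)%E.
Proof.
move=> mf fc; have two0 : 0 < 2 :> R by [].
have two_conj : 2^-1 + 2^-1 = 1 :> R by rewrite [RHS]splitr !div1r.
have := hoelder mu mf (measurable_cst (1 : R)) two0 two0 two_conj.
rewrite Lnorm1 Lnorm_cst1 [X in (_ * X)%E](_ : _ = 1%E); last first.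
  by rewrite -[RHS](poweR1r 2^-1); congr poweR; exact: probability_setT.
rewrite mule1.
by under eq_integral do rewrite /= mulr1; move=> /le_trans; exact.
Qed.

Lemma Lnorm2_L1 f c : measurable_fun setT f -> (N2 f <= c%:E)%E ->
  mu.-integrable setT (EFin \o f) /\ `|\int[mu]_x f x| <= c.
Proof.
move=> mf fc; have int_le := Lnorm2_int_abs mf fc.
have fi : mu.-integrable setT (EFin \o f).
  apply/integrableP; split; first exact/measurable_EFinP.
  by rewrite (le_lt_trans int_le)// ltry.
split=> //; rewrite -lee_fin EFin_normr_Rintegral//.
by rewrite (le_trans _ int_le)//; apply: le_abse_integral => //; exact/measurable_EFinP.
Qed.

End L2_norm.

Section truncation.
Context d (X : measurableType d) (R : realType).

Definition trunc (f : X -> R) (n : nat) : X -> R :=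
  fun x => if `|f x| <= n%:R then f x else 0.

Lemma norm_trunc_le f n x : `|trunc f n x| <= `|f x|.
Proof. by rewrite /trunc; case: ifP; rewrite ?normr0. Qed.

Lemma bmeas_trunc f n : measurable_fun setT f -> trunc f n \in @bmeas _ X R.
Proof.
move=> mf; apply: bmeasP; last first.
  by exists n%:R => x; rewrite /trunc; case: ifP => // _; rewrite normr0.
apply: measurable_fun_ifT => //.
by apply: measurable_fun_ler => //; apply: measurableT_comp.
Qed.

Lemma cvg_trunc f x : (fun n => trunc f n x) @ \oo --> f x.
Proof.
apply: cvg_near_cst; near=> n; rewrite /trunc ifT//.
by near: n; exact: nbhs_infty_ger.
Unshelve. all: by end_near. Qed.

Lemma cvg_Rintegral_trunc (mu : {measure set X -> \bar R}) f :
  mu.-integrable setT (EFin \o f) ->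
  (fun n => \int[mu]_x trunc f n x) @ \oo --> \int[mu]_x f x.
Proof.
move=> fi; have /measurable_EFinP mf := measurable_int _ fi.
have mtr n : measurable_fun setT (EFin \o trunc f n).
  by apply/measurable_EFinP; have /set_mem[] := bmeas_trunc n mf.
have [|||||_ _ h] := @dominated_convergence _ _ _ mu setT measurableT
  (fun n => EFin \o trunc f n) (EFin \o f) (fun x => `|(f x)%:E|%E).
- by [].
- exact/measurable_EFinP.
- by apply: aeW => x _; apply: cvg_EFin; [exact: nearW|exact: cvg_trunc].
- exact: integrable_abse.
- by apply: aeW => x n _; rewrite lee_fin norm_trunc_le.
rewrite /Rintegral; apply: fine_cvg; rewrite fineK//.
exact: integrable_fin_num.
Qed.

End truncation.

(** * Completeness for geometrically decaying series *)

Section riesz_fischer.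
Context d (X : measurableType d) (R : realType) (mu : probability X R).
Local Notation N2 f := (Lnorm mu 2%:E (fun x => (f x)%:E)).

(** On a probability space the [L^1] norms are bounded by the [L^2] norms and hence summable, so the
    series converges absolutely almost everywhere; Fatou's lemma then bounds its tails. *)
Lemma riesz_fischer_geometric (a : nat -> X -> R) (C q : R) :
  0 <= C -> 0 <= q -> q < 1 ->
  (forall n, measurable_fun setT (a n)) ->
  (forall n, (N2 (a n) <= (C * q ^+ n)%:E)%E) ->
  exists2 h : X -> R, measurable_fun setT h & forall N,
    (N2 (fun x => h x - \sum_(n < N) a n x)%R <= (C / (1 - q) * q ^+ N)%:E)%E.
Proof.
move=> C0 q0 q1 ma aC.
have Cq0 n : 0 <= C * q ^+ n by rewrite mulr_ge0 ?exprn_ge0.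
pose S x := (\sum_(n <oo) `|(a n x)%:E|)%E.
have mabs n : measurable_fun setT (fun x => `|(a n x)%:E|%E).
  by apply: measurableT_comp => //; exact/measurable_EFinP.
have S0 x : (0 <= S x)%E by exact: nneseries_ge0.
have mS : measurable_fun setT S by exact: ge0_emeasurable_sum.
have geo M : \sum_(n < M) q ^+ n <= (1 - q)^-1.
  rewrite -[leRHS]mul1r ler_pdivlMr ?subr_gt0//.
  rewrite mulrC -opprB mulNr -subrX1 opprB gerBl exprn_ge0//.
have Sint : mu.-integrable setT S.
  apply/integrableP; split => //.
  under eq_integral do rewrite gee0_abs//.
  rewrite integral_nneseries//; apply: (@le_lt_trans _ _ (C / (1 - q))%:E); last first.
    by rewrite ltry.
  apply: lime_le; first by apply: is_cvg_nneseries => n _ _; exact: integral_ge0.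
  apply: nearW => N; rewrite big_mkord.
  apply: (@le_trans _ _ (\sum_(n < N) (C * q ^+ n)%:E)%E).
    apply: lee_sum => n _; exact: Lnorm2_int_abs.
  by rewrite sumEFin lee_fin -mulr_sumr ler_wpM2l.
pose E := [set x | (S x < +oo)%E].
have mE : measurable E.
  by rewrite -[E]setTI; apply: emeasurable_fun_infty_o.
have aE : {ae mu, forall x, E x}.
  have := integrable_ae measurableT Sint; apply: filterS => x /(_ Logic.I).
  by rewrite ge0_fin_numE.
(* Cutting the terms off outside [E] makes the series converge everywhere, so that its limit is
   measurable. *)
pose a' n x := a n x * \1_E x.
have cvga' x : cvgn (series (fun n => a' n x)).
  rewrite /a' indicE; have [/set_mem Ex|_] := boolP (x \in E); last first.
    apply: (@is_cvg_near_cst _ _ 0); apply: nearW => n.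
    by rewrite /series /= big1// => i _; rewrite mulr0.
  apply: normed_cvg; under eq_fun do rewrite mulr1.
  apply: nondecreasing_is_cvgn.
    apply/nondecreasing_seqP => n.
    by rewrite [leRHS]seriesSr lerDl normr_ge0.
  exists (fine (S x)) => _ [n _ <-]; rewrite -lee_fin fineK ?ge0_fin_numE//.
  rewrite /series /= -sumEFin; apply: nneseries_lim_ge => *.
  by rewrite lee_fin normr_ge0.
pose h x := limn (series (fun n => a' n x)).
have ma' n : measurable_fun setT (a' n).
  by apply: measurable_funM => //; exact: measurable_indic.
have msum (b : nat -> X -> R) N : (forall n, measurable_fun setT (b n)) ->
    measurable_fun setT (fun x => \sum_(n < N) b n x).
  by move=> mb; exact: measurable_sum.
have mh : measurable_fun setT h.
  apply: measurable_fun_cvg (fun x _ => cvga' x) => n.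
  rewrite /series /=; under eq_fun do rewrite big_mkord.
  exact: (msum a').
exists h => // N.
have CqN : 0 <= C / (1 - q) * q ^+ N.
  by rewrite mulr_ge0 ?exprn_ge0 ?divr_ge0// subr_ge0 ltW.
apply: (@Lnorm2_fatou _ _ _ _ (fun M x => \sum_(n < M) a (N + n)%N x)) => //.
- by move=> M; exact: (msum (fun n => a (N + n)%N)).
- by apply: measurable_funB => //; exact: (msum a).
- apply: filterS aE => x Ex.
  have tailE M : \sum_(n < M) a (N + n)%N x =
      series (fun n => a' n x) (M + N)%N - \sum_(n < N) a n x.
    rewrite /series /= big_mkord addnC big_split_ord /= addrAC -sumrB.
    rewrite [X in _ = X + _]big1 ?add0r; last first.
      by move=> n _; rewrite /a' indicE mem_set// mulr1 subrr.
    by apply: eq_bigr => n _; rewrite /a' indicE mem_set// mulr1.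
  under eq_fun do rewrite tailE; apply: cvgB; last exact: cvg_cst.
  by have := cvga' x; rewrite -(cvg_shiftn N).
apply: nearW => M.
have partial : (N2 (fun x => \sum_(n < M) a (N + n)%N x)%R <=
    (\sum_(n < M) C * q ^+ (N + n))%:E)%E.
  elim: M => [|M IHM].
    rewrite big_ord0; under [X in Lnorm _ _ X]eq_fun do rewrite big_ord0.
    by rewrite (Lnorm0 mu).
  rewrite big_ord_recr; under [X in Lnorm _ _ X]eq_fun do rewrite big_ord_recr.
  by apply: Lnorm2D_le => //; exact: (msum (fun n => a (N + n)%N)).
apply: le_trans partial _; rewrite lee_fin.
under eq_bigr do rewrite exprD mulrA.
by rewrite -mulr_sumr [leLHS]mulrAC ler_wpM2r ?exprn_ge0// ler_wpM2l.
Qed.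

End riesz_fischer.

(** * From bounded functions to square-integrable ones *)

Section L2_extension.
Context d (X : measurableType d) (R : realType) (P : R.-pker X ~> X).
Context (pi : probability X R) (l : R).
Local Notation N2 f := (Lnorm pi 2%:E (fun x => (f x)%:E)).
Local Notation ip := (bip pi).
Local Notation one := (bone X R).
Local Notation T := (bavg P).
Hypothesis T_inv : invariant P pi.
Hypothesis l_ge0 : 0 <= l.
Hypothesis T_le : forall f, ip f one = 0 ->
  sip_norm ip (T f) <= l * sip_norm ip f.

Definition average (f : X -> R) : X -> R := fun x => \int[P x]_y f y.

Lemma Lnorm2_bfun (f : bfun X R) : N2 f = (sip_norm ip f)%:E.
Proof.
apply/eqP; rewrite eq_le Lnorm2_le ?sip_norm_ge0// sqr_sip_norm; last exact: bip_sip.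
have intE : (\int[pi]_x ((f x) ^+ 2)%:E = (ip f f)%:E)%E.
  by rewrite /bip -integral_bfun; [apply: eq_integral => x _; rewrite expr2|exact: prob_lty].
rewrite intE lexx /= Lnorm2E intE poweR_EFin lee_fin.
by rewrite powR12_sqrt// (sip_ge0 (bip_sip pi)).
Qed.

Lemma ae_integrable_average f : pi.-integrable setT (EFin \o f) ->
  {ae pi, forall x, (P x).-integrable setT (EFin \o f)}.
Proof.
move=> fi; have [] := integrable_mixture (measurable_kernel P)
  (fun B mB => esym (T_inv mB)) fi.
by [].
Qed.

Lemma Rintegral_average f : pi.-integrable setT (EFin \o f) ->
  \int[pi]_x average f x = \int[pi]_x f x.
Proof.
move=> fi; have [_ _ ->] := integrable_mixture (measurable_kernel P)
  (fun B mB => esym (T_inv mB)) fi.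
by [].
Qed.

Lemma Lnorm2_average_le f c : 0 <= c -> measurable_fun setT f ->
  \int[pi]_x f x = 0 -> (N2 f <= c%:E)%E -> (N2 (average f) <= (l * c)%:E)%E.
Proof.
move=> c0 mf f0 fc; have [fi _] := Lnorm2_L1 mf fc.
pose tr n : bfun X R := BFun (bmeas_trunc n mf).
(* Truncation destroys the mean zero that [T_le] requires; centring restores it, does not increase
   the norm, and vanishes in the limit as [m n] tends to the mean of [f]. *)
pose m n := \int[pi]_x tr n x; pose g n := tr n - m n *: one.
have sip := bip_sip pi.
have one1 : ip one one = 1.
  by rewrite bip1 Rintegral_bone; exact: (congr1 fine (probability_setT pi)).
have g_mean n : ip (g n) one = 0.
  by rewrite /g (sipBl sip) (sipZl sip) one1 bip1 mulr1 subrr.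
have g_le n : sip_norm ip (g n) <= sip_norm ip (tr n).
  rewrite /sip_norm ler_wsqrtr// /g (sipBl sip) !(sipBr sip).
  rewrite !(sipZl sip, sipZr sip) one1 (sipC sip one) bip1 -/(m n) mulr1 subrr subr0.
  by have := sqr_ge0 (m n); rewrite expr2; lra.
apply: (@Lnorm2_fatou _ _ _ _ (fun n => T (g n))); rewrite ?mulr_ge0//.
- by move=> n; exact: measurable_bfun.
- exact: measurable_average.
- apply: filterS (ae_integrable_average fi) => x fix_.
  have Tg n : T (g n) x = \int[P x]_y tr n y - m n.
    rewrite /g linearB linearZ bfunB bfunZ; congr (_ - _).
    have T1 : bavg P one x = 1 by rewrite bavg1.
    exact: (etrans (congr1 _ T1) (mulr1 _)).
  under eq_fun do rewrite Tg.
  rewrite -[average f x]subr0 -[X in _ - X]f0.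
  by apply: cvgB; exact: cvg_Rintegral_trunc.
apply: nearW => n; rewrite Lnorm2_bfun lee_fin (le_trans (T_le (g_mean n)))//.
rewrite ler_wpM2l// (le_trans (g_le n))// -lee_fin -Lnorm2_bfun.
apply: le_trans fc; apply: Lnorm2_mono => //; first exact: measurable_bfun.
exact: norm_trunc_le.
Qed.

End L2_extension.

(** * Complex square-integrable functions *)

Section complex_functions.
Context d (X : measurableType d) (R : realType).
Local Notation Re := complex.Re.
Local Notation Im := complex.Im.
Local Notation normc := ComplexField.Normc.normc.

Lemma ReM (x y : R[i]) : Re (x * y) = Re x * Re y - Im x * Im y.
Proof. by case: x; case: y. Qed.

Lemma ImM (x y : R[i]) : Im (x * y) = Re x * Im y + Im x * Re y.
Proof. by case: x; case: y. Qed.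

Lemma sqr_normcE (x : R[i]) : normc x ^+ 2 = Re x ^+ 2 + Im x ^+ 2.
Proof. by case: x => a b /=; rewrite sqr_sqrtr// addr_ge0 ?sqr_ge0. Qed.

Lemma normc_ge0 (x : R[i]) : 0 <= normc x.
Proof. by case: x => a b /=; rewrite sqrtr_ge0. Qed.

Lemma norm_Re_le (x : R[i]) : `|Re x| <= normc x.
Proof.
rewrite -(@ler_pXn2r _ 2)// ?nnegrE ?normc_ge0// sqr_normcE real_normK ?num_real//.
by rewrite lerDl sqr_ge0.
Qed.

Lemma norm_Im_le (x : R[i]) : `|Im x| <= normc x.
Proof.
rewrite -(@ler_pXn2r _ 2)// ?nnegrE ?normc_ge0// sqr_normcE real_normK ?num_real//.
by rewrite lerDr sqr_ge0.
Qed.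

Definition cmeasurable (f : X -> R[i]) : Prop :=
  measurable_fun setT (fun x => Re (f x)) /\
  measurable_fun setT (fun x => Im (f x)).

Lemma cmeasurableD f g : cmeasurable f -> cmeasurable g ->
  cmeasurable (fun x => f x + g x).
Proof.
move=> [f1 f2] [g1 g2]; split.
- by under eq_fun do rewrite raddfD; exact: measurable_funD.
- by under eq_fun do rewrite raddfD; exact: measurable_funD.
Qed.

Lemma cmeasurableZ w f : cmeasurable f -> cmeasurable (fun x => w * f x).
Proof.
move=> [f1 f2]; split.
- under eq_fun do rewrite ReM.
  by apply: measurable_funB; apply: measurable_funM => //; exact: measurable_cst.
- under eq_fun do rewrite ImM.
  by apply: measurable_funD; apply: measurable_funM => //; exact: measurable_cst.
Qed.

Lemma cmeasurableB f g : cmeasurable f -> cmeasurable g ->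
  cmeasurable (fun x => f x - g x).
Proof.
move=> mf mg; have := cmeasurableD mf (cmeasurableZ (-1) mg).
by under eq_fun do rewrite mulN1r.
Qed.

Lemma measurable_normc f : cmeasurable f ->
  measurable_fun setT (fun x => normc (f x)).
Proof.
move=> [f1 f2]; rewrite (_ : (fun x => normc (f x)) =
    Num.sqrt \o (fun x => Re (f x) ^+ 2 + Im (f x) ^+ 2)).
  apply: measurableT_comp; last by apply: measurable_funD; exact: measurable_funX.
  by apply: continuous_measurable_fun; exact: sqrt_continuous.
by apply/funext => x /=; case: (f x).
Qed.

End complex_functions.

Section complex_L2.
Context d (X : measurableType d) (R : realType) (pi : probability X R).
Local Notation Re := complex.Re.
Local Notation Im := complex.Im.
Local Notation normc := ComplexField.Normc.normc.
Local Notation N2 f := (Lnorm pi 2%:E (fun x => (f x)%:E)).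
Implicit Types f g : X -> R[i].

Lemma LfunP2 (f : X -> R) : (f \in Lfun pi 2%:E) <->
  measurable_fun setT f /\ (N2 f < +oo)%E.
Proof.
split; first by move=> /andP[/set_mem mf /set_mem].
by move=> [mf ff]; apply/andP; split; apply/mem_set.
Qed.

Lemma Lnorm2_Re_le f c : cmeasurable f -> (L2norm pi f <= c%:E)%E ->
  (N2 (fun x => Re (f x)) <= c%:E)%E.
Proof.
move=> mf; apply: le_trans; apply: Lnorm2_mono; first exact: mf.1.
  exact: measurable_normc.
by move=> x; rewrite [leRHS]ger0_norm ?normc_ge0 ?norm_Re_le.
Qed.

Lemma Lnorm2_Im_le f c : cmeasurable f -> (L2norm pi f <= c%:E)%E ->
  (N2 (fun x => Im (f x)) <= c%:E)%E.
Proof.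
move=> mf; apply: le_trans; apply: Lnorm2_mono; first exact: mf.2.
  exact: measurable_normc.
by move=> x; rewrite [leRHS]ger0_norm ?normc_ge0 ?norm_Im_le.
Qed.

Lemma L2norm_le_ReIm f c c' : cmeasurable f ->
  (N2 (fun x => Re (f x)) <= c%:E)%E -> (N2 (fun x => Im (f x)) <= c'%:E)%E ->
  (L2norm pi f <= (c + c')%:E)%E.
Proof.
move=> mf fc fc'; have mabs (u : X -> R) : measurable_fun setT u ->
    measurable_fun setT (fun x => `|u x|) by move=> mu; exact: measurableT_comp.
have N2abs (u : X -> R) a : measurable_fun setT u -> (N2 u <= a%:E)%E ->
    (N2 (fun x => `|u x|) <= a%:E)%E.
  by move=> mu; apply: le_trans; apply: Lnorm2_mono => //;
     [exact: mabs|move=> x; rewrite normr_id].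
have := Lnorm2D_le (mabs _ mf.1) (mabs _ mf.2) (N2abs _ _ mf.1 fc) (N2abs _ _ mf.2 fc').
apply: le_trans; apply: Lnorm2_mono; first exact: measurable_normc.
  by apply: measurable_funD; apply: mabs; [exact: mf.1|exact: mf.2].
move=> x; rewrite (ger0_norm (normc_ge0 _)) [leRHS]ger0_norm ?addr_ge0//.
rewrite -(@ler_pXn2r _ 2)// ?nnegrE ?normc_ge0 ?addr_ge0//.
rewrite sqr_normcE sqrrD !real_normK ?num_real// addrAC lerDl.
by rewrite mulrn_wge0// mulr_ge0.
Qed.

Lemma HHP f : HH pi f <-> [/\ cmeasurable f, (L2norm pi f < +oo)%E,
  \int[pi]_x Re (f x) = 0 & \int[pi]_x Im (f x) = 0].
Proof.
split=> [[[/LfunP2[m1 n1] /LfunP2[m2 n2]] [i1 i2]]|[mf nf i1 i2]].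
  split=> //; have [c _ Ec] := Lnorm2_fin n1; have [c' _ Ec'] := Lnorm2_fin n2.
  apply: (@le_lt_trans _ _ (c + c')%:E); last by rewrite ltry.
  by apply: L2norm_le_ReIm; rewrite ?Ec ?Ec'.
have [c _ Ec] := Lnorm2_fin nf; have Ec' : (L2norm pi f <= c%:E)%E by rewrite -Ec.
split; last by rewrite /cintegral i1 i2.
split; apply/LfunP2; split; [exact: mf.1| |exact: mf.2| ].
- by rewrite (le_lt_trans (Lnorm2_Re_le mf Ec'))// ltry.
- by rewrite (le_lt_trans (Lnorm2_Im_le mf Ec'))// ltry.
Qed.

Lemma L2norm_fin f : (L2norm pi f < +oo)%E ->
  exists2 c : R, 0 <= c & L2norm pi f = c%:E.
Proof. exact: Lnorm2_fin. Qed.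

Lemma L2normD_le f g c c' : cmeasurable f -> cmeasurable g ->
  (L2norm pi f <= c%:E)%E -> (L2norm pi g <= c'%:E)%E ->
  (L2norm pi (fun x => f x + g x)%R <= (c + c')%:E)%E.
Proof.
move=> mf mg fc gc; apply: le_trans (Lnorm2D_le _ _ fc gc); last 2 first.
- exact: measurable_normc.
- exact: measurable_normc.
apply: Lnorm2_mono.
- by apply: measurable_normc; exact: cmeasurableD.
- by apply: measurable_funD; exact: measurable_normc.
move=> x; rewrite !ger0_norm ?addr_ge0 ?normc_ge0//.
exact: le_normcD.
Qed.

Lemma L2normZ_le w f c : cmeasurable f -> 0 <= c ->
  (L2norm pi f <= c%:E)%E ->
  (L2norm pi (fun x => w * f x)%R <= (normc w * c)%:E)%E.
Proof.
move=> mf c0 fc; have := Lnorm2Z_le (normc w) (measurable_normc mf) c0 fc.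
rewrite ger0_norm ?normc_ge0//; apply: le_trans; apply: Lnorm2_mono.
- by apply: measurable_normc; exact: cmeasurableZ.
- by apply: measurable_funM; [exact: measurable_cst|exact: measurable_normc].
by move=> x; rewrite ComplexField.Normc.normcM.
Qed.

Lemma HH_integrable f : HH pi f ->
  pi.-integrable setT (fun x => (Re (f x))%:E) /\
  pi.-integrable setT (fun x => (Im (f x))%:E).
Proof.
move=> /HHP[mf nf _ _]; have [c _ Ec] := L2norm_fin nf.
have Ec' : (L2norm pi f <= c%:E)%E by rewrite Ec.
by split; [exact: (Lnorm2_L1 mf.1 (Lnorm2_Re_le mf Ec')).1
          |exact: (Lnorm2_L1 mf.2 (Lnorm2_Im_le mf Ec')).1].
Qed.

Lemma HHD f g : HH pi f -> HH pi g -> HH pi (fun x => f x + g x).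
Proof.
move=> Hf Hg; have [f1 f2] := HH_integrable Hf; have [g1 g2] := HH_integrable Hg.
move: Hf Hg => /HHP[mf nf fr fi] /HHP[mg ng gr gi]; apply/HHP.
have [c _ Ec] := L2norm_fin nf; have [c' _ Ec'] := L2norm_fin ng.
split; first exact: cmeasurableD.
- apply: (@le_lt_trans _ _ (c + c')%:E); last by rewrite ltry.
  by apply: L2normD_le; rewrite ?Ec ?Ec'.
- under eq_Rintegral do rewrite raddfD /=.
  by rewrite RintegralD// fr gr addr0.
- under eq_Rintegral do rewrite raddfD /=.
  by rewrite RintegralD// fi gi addr0.
Qed.

Lemma HHZ w f : HH pi f -> HH pi (fun x => w * f x).
Proof.
move=> Hf; have [f1 f2] := HH_integrable Hf.
move: Hf => /HHP[mf nf fr fi]; apply/HHP.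
have [c c0 Ec] := L2norm_fin nf.
have intZ (k : R) (u : X -> R) : pi.-integrable setT (EFin \o u) ->
    pi.-integrable setT (fun x => (k * u x)%:E).
  by move=> ui; exact: (integrableZl measurableT k ui).
split; first exact: cmeasurableZ.
- apply: (@le_lt_trans _ _ (normc w * c)%:E); last by rewrite ltry.
  by apply: L2normZ_le; rewrite ?Ec.
- under eq_Rintegral do rewrite ReM.
  rewrite RintegralB//; [|exact: intZ|exact: intZ].
  by rewrite !RintegralZl// fr fi !mulr0 subrr.
- under eq_Rintegral do rewrite ImM.
  rewrite RintegralD//; [|exact: intZ|exact: intZ].
  by rewrite !RintegralZl// fr fi !mulr0 addr0.
Qed.

End complex_L2.

(** * The resolvent of the kernel *)

Section kernel_op.
Context d (X : measurableType d) (R : realType) (P : R.-pker X ~> X).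
Local Notation Re := complex.Re.
Local Notation Im := complex.Im.

Definition cintegrable (mu : {measure set X -> \bar R}) (f : X -> R[i]) : Prop :=
  mu.-integrable setT (fun x => (Re (f x))%:E) /\
  mu.-integrable setT (fun x => (Im (f x))%:E).

Lemma cintegrableZ mu w f : cintegrable mu f ->
  cintegrable mu (fun x => w * f x).
Proof.
move=> [f1 f2].
have intZ (k : R) (u : X -> R) : mu.-integrable setT (EFin \o u) ->
    mu.-integrable setT (fun x => (k * u x)%:E).
  by move=> ui; exact: (integrableZl measurableT k ui).
split.
- under eq_fun do rewrite ReM EFinB.
  by apply: integrableB => //; exact: intZ.
- under eq_fun do rewrite ImM EFinD.
  by apply: integrableD => //; exact: intZ.
Qed.

Lemma cintegrableD mu f g : cintegrable mu f -> cintegrable mu g ->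
  cintegrable mu (fun x => f x + g x).
Proof.
move=> [f1 f2] [g1 g2]; split.
- by under eq_fun do rewrite raddfD EFinD; exact: integrableD.
- by under eq_fun do rewrite raddfD EFinD; exact: integrableD.
Qed.

Lemma kernel_opZ w f x : cintegrable (P x) f ->
  kernel_op P (fun y => w * f y) x = w * kernel_op P f x.
Proof.
move=> [f1 f2].
have intZ (k : R) (u : X -> R) : (P x).-integrable setT (EFin \o u) ->
    (P x).-integrable setT (fun x => (k * u x)%:E).
  by move=> ui; exact: (integrableZl measurableT k ui).
rewrite /kernel_op /cintegral; apply/eqP; rewrite eq_complex ReM ImM /=.
apply/andP; split; apply/eqP.
- under eq_Rintegral do rewrite ReM.
  rewrite RintegralB//; [|exact: intZ|exact: intZ].
  by rewrite !RintegralZl.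
- under eq_Rintegral do rewrite ImM.
  rewrite RintegralD//; [|exact: intZ|exact: intZ].
  by rewrite !RintegralZl.
Qed.

Lemma kernel_opD f g x : cintegrable (P x) f -> cintegrable (P x) g ->
  kernel_op P (fun y => f y + g y) x = kernel_op P f x + kernel_op P g x.
Proof.
move=> [f1 f2] [g1 g2]; rewrite /kernel_op /cintegral.
apply/eqP; rewrite eq_complex; apply/andP; split; apply/eqP => /=.
- by under eq_Rintegral do rewrite raddfD /=; rewrite RintegralD.
- by under eq_Rintegral do rewrite raddfD /=; rewrite RintegralD.
Qed.

Lemma kernel_op_subr_sum (h : X -> R[i]) (g : nat -> X -> R[i]) N x :
  cintegrable (P x) h -> (forall n, cintegrable (P x) (g n)) ->
  cintegrable (P x) (fun y => h y - \sum_(n < N) g n y) /\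
  kernel_op P (fun y => h y - \sum_(n < N) g n y) x =
  kernel_op P h x - \sum_(n < N) kernel_op P (g n) x.
Proof.
move=> hi gi; elim: N => [|N [IH1 IH2]].
  rewrite big_ord0 subr0; under eq_fun do rewrite big_ord0 subr0.
  by split.
have gN : cintegrable (P x) (fun y => -1 * g N y) by exact: cintegrableZ.
have E y : h y - \sum_(n < N.+1) g n y =
    (h y - \sum_(n < N) g n y) + -1 * g N y.
  by rewrite big_ord_recr/= opprD addrA mulN1r.
under eq_fun do rewrite E; split; first exact: cintegrableD.
rewrite kernel_opD// kernel_opZ// IH2 big_ord_recr/= opprD addrA mulN1r//.
Qed.

End kernel_op.

Section resolvent.
Context d (X : measurableType d) (R : realType) (P : R.-pker X ~> X).
Context (pi : probability X R) (l : R).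
Local Notation Re := complex.Re.
Local Notation Im := complex.Im.
Local Notation normc := ComplexField.Normc.normc.
Local Notation N2 f := (Lnorm pi 2%:E (fun x => (f x)%:E)).
Hypothesis T_inv : invariant P pi.
Hypothesis l_ge0 : 0 <= l.
Hypothesis T_le : forall f, bip pi f (bone X R) = 0 ->
  sip_norm (bip pi) (bavg P f) <= l * sip_norm (bip pi) f.

Lemma cmeasurable_kernel_op f : cmeasurable f -> cmeasurable (kernel_op P f).
Proof. by move=> [f1 f2]; split; exact: measurable_average. Qed.

(** The constant [l] survives because [P] acts on real and imaginary parts separately and their
    squared norms add up to that of [f]. *)
Lemma HH_kernel_op f c : 0 <= c -> HH pi f -> (L2norm pi f <= c%:E)%E ->
  HH pi (kernel_op P f) /\ (L2norm pi (kernel_op P f) <= (l * c)%:E)%E.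
Proof.
move=> c0 Hf fc; have [f1 f2] := HH_integrable Hf.
have [mf nf fr fi] := (HHP pi f).1 Hf.
have [c1 c10 E1] : exists2 c1, 0 <= c1 & N2 (fun x => Re (f x)) = c1%:E.
  by apply: Lnorm2_fin; rewrite (le_lt_trans (Lnorm2_Re_le mf fc))// ltry.
have [c2 c20 E2] : exists2 c2, 0 <= c2 & N2 (fun x => Im (f x)) = c2%:E.
  by apply: Lnorm2_fin; rewrite (le_lt_trans (Lnorm2_Im_le mf fc))// ltry.
have sqE (u v : X -> R) : measurable_fun setT u -> measurable_fun setT v ->
    (\int[pi]_x ((u x ^+ 2 + v x ^+ 2)%R)%:E =
     \int[pi]_x (u x ^+ 2)%:E + \int[pi]_x (v x ^+ 2)%:E)%E.
  move=> mu mv; under eq_integral do rewrite EFinD.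
  rewrite ge0_integralD//.
  - by move=> x _; rewrite lee_fin sqr_ge0.
  - by apply/measurable_EFinP; exact: measurable_funX.
  - by move=> x _; rewrite lee_fin sqr_ge0.
  - by apply/measurable_EFinP; exact: measurable_funX.
have intsq (u : X -> R) k : N2 u = k%:E -> 0 <= k ->
    (\int[pi]_x (u x ^+ 2)%:E = (k ^+ 2)%:E)%E.
  by move=> uk k0; rewrite -poweR_Lnorm2 uk poweR_EFin powR_mulrn.
have cc : c1 ^+ 2 + c2 ^+ 2 <= c ^+ 2.
  move: fc; rewrite /L2norm Lnorm2_le//.
  under eq_integral do rewrite sqr_normcE.
  by rewrite (sqE _ _ mf.1 mf.2) (intsq _ _ E1)// (intsq _ _ E2).
have mTf := cmeasurable_kernel_op mf.
have T1 : (N2 (fun x => Re (kernel_op P f x)) <= (l * c1)%:E)%E.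
  by apply: (Lnorm2_average_le T_inv l_ge0 T_le) => //; [exact: mf.1|rewrite E1].
have T2 : (N2 (fun x => Im (kernel_op P f x)) <= (l * c2)%:E)%E.
  by apply: (Lnorm2_average_le T_inv l_ge0 T_le) => //; [exact: mf.2|rewrite E2].
have Tc : (L2norm pi (kernel_op P f) <= (l * c)%:E)%E.
  rewrite /L2norm Lnorm2_le ?mulr_ge0//.
  under eq_integral do rewrite sqr_normcE.
  rewrite (sqE _ _ mTf.1 mTf.2).
  rewrite !Lnorm2_le ?mulr_ge0// in T1 T2.
  apply: (le_trans (leeD T1 T2)); rewrite -EFinD lee_fin !exprMn -mulrDr.
  by rewrite ler_wpM2l ?sqr_ge0.
split=> //; apply/HHP; split => //.
- by rewrite (le_lt_trans Tc)// ltry.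
- by rewrite -fr; exact: Rintegral_average.
- by rewrite -fi; exact: Rintegral_average.
Qed.

(** The triangle inequality for [z * f = P f - (P - z) f]. *)
Lemma shifted_op_bounded_below z f : l < normc z -> HH pi f ->
  (L2norm pi f <= ((normc z - l)^-1)%:E * L2norm pi (shifted_op P z f))%E.
Proof.
move=> lz Hf; have zl : 0 < normc z - l by rewrite subr_gt0.
have z0 : 0 < normc z by exact: le_lt_trans lz.
have zN0 : z != 0.
  by apply: contraTneq z0 => ->; rewrite ComplexField.Normc.normc0 ltxx.
have [mf nf _ _] := (HHP pi f).1 Hf.
have [c c0 Ec] := L2norm_fin nf.
have [->|] := eqVneq (L2norm pi (shifted_op P z f)) +oo%E.
  by rewrite gt0_muley ?leey// lte_fin invr_gt0.
rewrite -ltey => /L2norm_fin[c' c'0 Ec'].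
have [Hk kc] : HH pi (kernel_op P f) /\
    (L2norm pi (kernel_op P f) <= (l * c)%:E)%E.
  by apply: HH_kernel_op; rewrite ?Ec.
have mk := cmeasurable_kernel_op mf.
have ms : cmeasurable (shifted_op P z f).
  by apply: cmeasurableB => //; exact: cmeasurableZ.
have : (L2norm pi (fun x => z^-1 * (kernel_op P f x + -1 * shifted_op P z f x))%R <=
    (normc z^-1 * (l * c + normc (-1) * c'))%:E)%E.
  apply: L2normZ_le.
  - by apply: cmeasurableD => //; exact: cmeasurableZ.
  - by rewrite addr_ge0 ?mulr_ge0 ?normc_ge0.
  apply: L2normD_le => //; first exact: cmeasurableZ.
  by apply: L2normZ_le; rewrite ?Ec'.
have -> : (fun x => z^-1 * (kernel_op P f x + -1 * shifted_op P z f x)) = f.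
  apply/funext => x; rewrite /shifted_op mulN1r opprB addrC subrK.
  by rewrite mulrA mulVf// mul1r.
rewrite Ec Ec' !lee_fin ComplexField.Normc.normcV.
have -> : normc (-1 : R[i]) = 1 by rewrite normcN ComplexField.Normc.normc1.
rewrite mul1r ler_pdivlMl// ler_pdivlMl//; lra.
Qed.

Lemma L2norm_eq0 f : cmeasurable f -> L2norm pi f = 0%E ->
  {ae pi, forall x, f x = 0}.
Proof.
move=> mf /Lnorm_eq0_eq0.
have mn : measurable_fun setT (fun x => (normc (f x))%:E).
  by apply/measurable_EFinP; exact: measurable_normc.
move=> /(_ mn); rewrite lte_fin ltr0n => /(_ isT).
apply: filterS => x /(_ Logic.I) [].
exact: ComplexField.Normc.eq0_normc.
Qed.

(* Neumann series [f = - z^-1 * sum_n z^-n P^n g]; [e N] is the tail of the series. *)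
Lemma neumann_surjective z g : l < normc z -> HH pi g ->
  exists2 f, HH pi f & {ae pi, forall x, shifted_op P z f x = g x}.
Proof.
move=> lz Hg; have z0 : 0 < normc z by exact: le_lt_trans lz.
have zN0 : z != 0.
  by apply: contraTneq z0 => ->; rewrite ComplexField.Normc.normc0 ltxx.
pose w := z^-1; pose q := l / normc z.
have nw : normc w = (normc z)^-1 by rewrite ComplexField.Normc.normcV.
have q0 : 0 <= q by rewrite divr_ge0// ltW.
have q1 : q < 1 by rewrite ltr_pdivrMr// mul1r.
have [_ ng _ _] := (HHP pi g).1 Hg.
have [C C0 EC] := L2norm_fin ng.
pose gs n := iter n (fun h x => w * kernel_op P h x) g.
have gsP n : HH pi (gs n) /\ (L2norm pi (gs n) <= (C * q ^+ n)%:E)%E.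
  elim: n => [|n [IH1 IH2]]; first by rewrite mulr1 EC.
  have Cq : 0 <= C * q ^+ n by rewrite mulr_ge0 ?exprn_ge0.
  have [Hk kC] := HH_kernel_op Cq IH1 IH2.
  have [mk _ _ _] := (HHP pi _).1 Hk.
  split; first exact: HHZ.
  have := L2normZ_le w mk (mulr_ge0 l_ge0 Cq) kC.
  rewrite nw (_ : _^-1 * (l * (C * q ^+ n)) = C * q ^+ n.+1)//.
  by rewrite exprS /q; ring.
have mgs n : cmeasurable (gs n) by have [/HHP[]] := gsP n.
(* Real and imaginary parts are summed separately, at the cost of the factor [2] in [e_le]. *)
have [a ma aN] := riesz_fischer_geometric C0 q0 q1 (fun n => (mgs n).1)
  (fun n => Lnorm2_Re_le (mgs n) (gsP n).2).
have [b mb bN] := riesz_fischer_geometric C0 q0 q1 (fun n => (mgs n).2)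
  (fun n => Lnorm2_Im_le (mgs n) (gsP n).2).
pose K := C / (1 - q); have K0 : 0 <= K by rewrite divr_ge0// subr_ge0 ltW.
have Kq0 N : 0 <= K * q ^+ N by rewrite mulr_ge0 ?exprn_ge0.
pose h x := Complex (a x) (b x).
pose e N x : R[i] := h x - \sum_(n < N) gs n x.
have Ree N x : Re (e N x) = a x - \sum_(n < N) Re (gs n x).
  by rewrite /e raddfB raddf_sum.
have Ime N x : Im (e N x) = b x - \sum_(n < N) Im (gs n x).
  by rewrite /e raddfB raddf_sum.
have mh : cmeasurable h by [].
have msum (u : nat -> X -> R) N : (forall n, measurable_fun setT (u n)) ->
    measurable_fun setT (fun x => \sum_(n < N) u n x).
  by move=> mu; exact: measurable_sum.
have me N : cmeasurable (e N).
  split.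
  - under eq_fun do rewrite Ree.
    apply: measurable_funB => //.
    exact: (msum (fun n x => Re (gs n x)) _ (fun n => (mgs n).1)).
  - under eq_fun do rewrite Ime.
    apply: measurable_funB => //.
    exact: (msum (fun n x => Im (gs n x)) _ (fun n => (mgs n).2)).
have e_le N : (L2norm pi (e N) <= (2 * (K * q ^+ N))%:E)%E.
  rewrite mulr_natl mulr2n; apply: L2norm_le_ReIm => //.
  - by under [X in Lnorm _ _ X]eq_fun do rewrite Ree; exact: aN.
  - by under [X in Lnorm _ _ X]eq_fun do rewrite Ime; exact: bN.
have cvgKq c : (fun N => c * (K * q ^+ N)) @ \oo --> 0.
  have -> : 0 = c * (K * 0) :> R by rewrite !mulr0.
  by do 2 apply: cvgMr; apply: cvg_expr; rewrite ger0_norm.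
have small c (x : R) : (forall N, `|x| <= c * (K * q ^+ N)) -> x = 0.
  move=> xc; apply/eqP; rewrite -normr_le0 -(cvg_lim _ (cvgKq c))//.
  apply: limr_ge; first by apply/cvg_ex; eexists; exact: cvgKq.
  exact: nearW.
(* The terms [v n] have mean zero, so the mean of [u] is that of every tail, which is arbitrarily
   small. *)
have mean0 (u : X -> R) (v : nat -> X -> R) : measurable_fun setT u ->
    (forall n, measurable_fun setT (v n)) ->
    (forall n, pi.-integrable setT (EFin \o v n)) ->
    (forall n, \int[pi]_x v n x = 0) ->
    (forall N, N2 (fun x => u x - \sum_(n < N) v n x)%R <= (K * q ^+ N)%:E)%E ->
    \int[pi]_x u x = 0.
  move=> mu mv vi v0 uN.
  have muv N : measurable_fun setT (fun x => u x - \sum_(n < N) v n x).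
    by apply: measurable_funB => //; exact: msum.
  apply: (small 1) => N; rewrite mul1r.
  suff -> : \int[pi]_x u x = \int[pi]_x (u x - \sum_(n < N) v n x).
    exact: (Lnorm2_L1 (muv N) (uN N)).2.
  elim: N => [|N IHN]; first by under [RHS]eq_Rintegral do rewrite big_ord0 subr0.
  under [RHS]eq_Rintegral do rewrite big_ord_recr opprD addrA /=.
  rewrite RintegralB//; first by rewrite -IHN v0 subr0.
  exact: (Lnorm2_L1 (muv N) (uN N)).1.
have Hh : HH pi h.
  apply/HHP; split => //.
  - have -> : h = e 0 by apply/funext => x; rewrite /e big_ord0 subr0.
    by rewrite (le_lt_trans (e_le 0))// ltry.
  - apply: (mean0 _ (fun n x => Re (gs n x))) => // n; first exact: (mgs n).1.
      exact: (HH_integrable (gsP n).1).1.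
    by have [/HHP[]] := gsP n.
  - apply: (mean0 _ (fun n x => Im (gs n x))) => // n; first exact: (mgs n).2.
      exact: (HH_integrable (gsP n).1).2.
    by have [/HHP[]] := gsP n.
have He N : HH pi (e N).
  elim: N => [|N IHN].
    by rewrite (_ : e 0 = h)//; apply/funext => x; rewrite /e big_ord0 subr0.
  rewrite (_ : e N.+1 = fun x => e N x + -1 * gs N x).
    by apply: HHD => //; apply: HHZ; exact: (gsP N).1.
  by apply/funext => x; rewrite /e big_ord_recr/= opprD addrA mulN1r.
have aecint (f : X -> R[i]) : HH pi f -> {ae pi, forall x, cintegrable (P x) f}.
  move=> /HH_integrable[f1 f2].
  apply: filterS2 (ae_integrable_average T_inv f1) (ae_integrable_average T_inv f2).
  by move=> x; split.
have aeint : {ae pi, forall x, cintegrable (P x) h /\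
    forall n, cintegrable (P x) (gs n)}.
  apply: filterS2 (aecint h Hh) (ae_foralln (fun n => aecint _ (gsP n).1)).
  by move=> x; split.
pose f x : R[i] := - w * h x; have Hf : HH pi f by exact: HHZ.
have mf : cmeasurable f by exact: cmeasurableZ.
pose D x : R[i] := shifted_op P z f x - g x.
have mg : cmeasurable g by exact: (mgs 0).
have mD : cmeasurable D.
  apply: cmeasurableB => //; apply: cmeasurableB; last exact: cmeasurableZ.
  exact: cmeasurable_kernel_op.
(* The terms of the series cancel, and the error [D] is expressed by tails alone; as [N] is
   arbitrary, its norm is [0]. *)
have DE N : {ae pi, forall x, D x = - w * kernel_op P (e N) x + e N.+1 x}.
  apply: filterS aeint => x [hi gi].
  have [_ ->] := kernel_op_subr_sum N hi gi.
  rewrite /D /shifted_op kernel_opZ// /e big_ord_recl.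
  have -> : \sum_(i < N) gs (lift ord0 i) x =
      w * \sum_(n < N) kernel_op P (gs n) x by rewrite mulr_sumr.
  have -> : z * f x = - h x by rewrite /f mulrA mulrN mulfV// mulN1r.
  have -> : gs (@ord0 N) x = g x by [].
  set s := \sum_(n < N) _; set t := kernel_op P h x; set y := h x; set v := g x.
  ring.
have nwN : normc (- w) = (normc z)^-1 by rewrite normcN nw.
have D_le N : (L2norm pi D <= ((2 * q + 2) * (K * q ^+ N))%:E)%E.
  have [Hk kl] := HH_kernel_op (mulr_ge0 (ler0n R 2) (Kq0 N)) (He N) (e_le N).
  have mk := cmeasurable_kernel_op (me N).
  have := L2normD_le (cmeasurableZ (- w) mk) (me N.+1)
    (L2normZ_le (- w) mk (mulr_ge0 l_ge0 (mulr_ge0 (ler0n R 2) (Kq0 N))) kl) (e_le N.+1).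
  rewrite nwN => le_sum.
  have Dle : (L2norm pi D <=
      L2norm pi (fun x => - w * kernel_op P (e N) x + e N.+1 x)%R)%E.
    apply: Lnorm2_mono_ae.
    - exact: measurable_normc.
    - apply: measurable_normc; apply: cmeasurableD => //; exact: cmeasurableZ.
    - by apply: filterS (DE N) => x ->.
  apply: le_trans Dle (le_trans le_sum _); rewrite lee_fin.
  have -> : (normc z)^-1 * (l * (2 * (K * q ^+ N))) = 2 * q * (K * q ^+ N).
    by rewrite /q; ring.
  rewrite [leRHS]mulrDl lerD2l ler_wpM2l// ler_wpM2l// exprS.
  by rewrite ler_piMl ?exprn_ge0// ltW.
exists f => //.
suff : {ae pi, forall x, D x = 0}.
  by apply: filterS => x /eqP; rewrite subr_eq0 => /eqP.
apply: L2norm_eq0 => //.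
have [c c0 Dc] : exists2 c : R, 0 <= c & L2norm pi D = c%:E.
  by apply: L2norm_fin; rewrite (le_lt_trans (D_le 0))// ltry.
rewrite Dc; congr EFin; apply: (small (2 * q + 2)) => N.
by rewrite ger0_norm// -lee_fin -Dc.
Qed.

Lemma resolvent_set_gt z : l < normc z -> resolvent_set P pi z.
Proof.
move=> lz; split.
- by move=> g Hg; exact: neumann_surjective.
- move=> f Hf sf0; have [mf _ _ _] := (HHP pi f).1 Hf.
  apply: L2norm_eq0 => //; apply/eqP; rewrite eq_le Lnorm_ge0 andbT.
  have := shifted_op_bounded_below lz Hf.
  suff -> : L2norm pi (shifted_op P z f) = 0%E by rewrite mule0.
  apply/eqP; rewrite eq_le Lnorm_ge0 andbT /L2norm.
  have p0 : 2%:E != 0%E :> \bar R by rewrite eqe pnatr_eq0.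
  rewrite -(Lnorm0 pi p0); apply: Lnorm2_mono_ae.
  + apply: measurable_normc; apply: cmeasurableB; last exact: cmeasurableZ.
    exact: cmeasurable_kernel_op.
  + exact: measurable_cst.
  + by apply: filterS sf0 => x ->; rewrite ComplexField.Normc.normc0.
- by exists (normc z - l)^-1 => f Hf; exact: shifted_op_bounded_below.
Qed.

End resolvent.

(** * The radius rho *)

Section rho.
Context d d' (X : measurableType d) (Omega : measurableType d') (R : realType).
Context (P : R.-pker X ~> X) (Pr : X -> probability Omega R).
Context (Phi : nat -> {mfun Omega >-> X}).
Hypothesis chain : markov_chain P Pr Phi.
Context (A : set X) (mA : measurable A) (kappa : R).
Hypothesis kappa_gt1 : 1 < kappa.
Hypothesis A_neq0 : A !=set0.
Local Notation fret := (fret P mA).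
Local Notation surv := (surv P mA).
Local Notation r := (rho Pr Phi A kappa).

Let even_series (s : R) (x : X) :=
  (\sum_(1 <= n <oo) ((s ^+ (2 * n))%:E * first_return Pr Phi (2 * n) x A))%E.

Lemma even_returnE (s : R) x n :
  ((s ^+ (2 * n.+1))%:E * first_return Pr Phi (2 * n.+1) x A =
   (s ^+ (2 * n.+1) * fret (2 * n).+1 x)%:E)%E.
Proof.
have -> : (2 * n.+1 = (2 * n).+2)%N by rewrite mulnS add2n.
by rewrite (first_returnE chain mA) EFinM.
Qed.

Lemma even_partial_sumE (s : R) x N :
  (\sum_(1 <= n < N.+1) ((s ^+ (2 * n))%:E * first_return Pr Phi (2 * n) x A) =
   (\sum_(n < N) s ^+ (2 * n.+1) * fret (2 * n).+1 x)%:E)%E.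
Proof.
rewrite big_add1 /= big_mkord -sumEFin; apply: eq_bigr => n _.
exact: even_returnE.
Qed.

Lemma even_term_ge0 (s : R) x n : 0 <= s -> (1 <= n)%N ->
  (0 <= (s ^+ (2 * n))%:E * first_return Pr Phi (2 * n) x A)%E.
Proof.
by move=> s0 _; rewrite mule_ge0 ?lee_fin ?exprn_ge0//; exact: measure_ge0.
Qed.

Lemma even_partial_sum_le (s : R) x N : 0 <= s ->
  ((\sum_(n < N) s ^+ (2 * n.+1) * fret (2 * n).+1 x)%:E <= even_series s x)%E.
Proof.
move=> s0; rewrite -even_partial_sumE; apply: nneseries_lim_ge => n n1 _.
exact: even_term_ge0.
Qed.

Lemma sum_odd_fret_le1 x N : \sum_(n < N) fret (2 * n).+1 x <= 1.
Proof.
apply: (@le_trans _ _ (1 - surv (2 * N) x)); last by rewrite gerBl surv_ge0.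
elim: N => [|N IHN]; first by rewrite big_ord0 muln0 subr_ge0.
have -> : (2 * N.+1 = (2 * N).+2)%N by rewrite mulnS.
have -> : \sum_(n < N.+1) fret (2 * n).+1 x =
    \sum_(n < N) fret (2 * n).+1 x + fret (2 * N).+1 x by rewrite big_ord_recr.
rewrite !survS !bfunB.
by have := fret_ge0 P mA (2 * N) x; move: IHN; lra.
Qed.

Lemma even_series_le (s : R) x : 0 <= s -> s <= 1 ->
  (even_series s x <= (s ^+ 2)%:E)%E.
Proof.
move=> s0 s1; apply: lime_le.
  by apply: is_cvg_nneseries => n n1 _; exact: even_term_ge0.
apply: nearW => -[|N].
  by rewrite big_geq// lee_fin sqr_ge0.
rewrite even_partial_sumE lee_fin.
apply: (@le_trans _ _ (\sum_(n < N) s ^+ 2 * fret (2 * n).+1 x)).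
  apply: ler_sum => n _; rewrite ler_wpM2r ?fret_ge0// mulnS exprD.
  by rewrite ler_piMr ?sqr_ge0// exprn_ile1.
by rewrite -mulr_sumr ler_piMr ?sqr_ge0// sum_odd_fret_le1.
Qed.

(** Even return times have total probability at most [1], so the series is at most [s ^ 2 < 1]. *)
Lemma rho_set_lt1 (s : R) : 0 <= s -> s < 1 -> rho_set Pr Phi A kappa s.
Proof.
move=> s0 s1; split=> //; first by rewrite (le_trans (ltW s1))// ltW.
apply: (@le_lt_trans _ _ (s ^+ 2)%:E); last first.
  by rewrite lte_fin exprn_ilt1.
by apply: ge_ereal_sup => _ [x _ <-]; apply: even_series_le => //; exact: ltW.
Qed.

Lemma rho_set_ubound : ubound (rho_set Pr Phi A kappa) kappa.
Proof. by move=> s []. Qed.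

Lemma rho_ge1 : 1 <= r.
Proof.
rewrite leNgt; apply/negP => r1.
have hub : has_ubound (rho_set Pr Phi A kappa).
  by exists kappa; exact: rho_set_ubound.
have r0 : 0 <= r by apply: (ub_le_sup hub); exact: rho_set_lt1.
have h : rho_set Pr Phi A kappa ((r + 1) / 2) by apply: rho_set_lt1; lra.
by have := ub_le_sup hub h; rewrite -/(rho Pr Phi A kappa); lra.
Qed.

Lemma rho_le : r <= kappa.
Proof.
apply: ge_sup; last exact: rho_set_ubound.
by exists 0; exact: rho_set_lt1.
Qed.

(** The supremum need not be attained: the margin [eta] is the one of some [s] in [rho_set] above
    [z], and it is uniform in [N]. *)
Lemma even_sum_lt1 x0 (z : R) : A x0 -> 0 <= z -> z < r ->
  exists2 eta : R, 0 < eta &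
  forall N, \sum_(n < N) z ^+ (2 * n.+1) * fret (2 * n).+1 x0 <= 1 - eta.
Proof.
move=> Ax0 z0 zr.
have ne : rho_set Pr Phi A kappa !=set0 by exists 0; exact: rho_set_lt1.
have [s [s0 sk s1] zs] := sup_gt ne zr.
have vlt1 : (even_series s x0 < 1)%E.
  by apply: le_lt_trans s1; apply: ereal_sup_ubound; exists x0.
have v0 : (0 <= even_series s x0)%E.
  by apply: nneseries_ge0 => n n1 _; exact: even_term_ge0.
have vfin : even_series s x0 \is a fin_num.
  by rewrite ge0_fin_numE// (lt_trans vlt1)// ltry.
exists (1 - fine (even_series s x0)).
  by rewrite subr_gt0 -lte_fin fineK.
move=> N; rewrite opprB addrC subrK -lee_fin fineK//.
apply: le_trans (even_partial_sum_le x0 N s0); rewrite lee_fin.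
apply: ler_sum => n _; rewrite ler_wpM2r ?fret_ge0//.
by rewrite lerXn2r// ?nnegrE// ltW.
Qed.

End rho.

Lemma var_dist_le d (X : measurableType d) (R : realType)
    (mu nu : probability X R) (c : R) :
  (forall f : bfun X R, (forall y, `|f y| <= 1) ->
    `|\int[mu]_x f x - \int[nu]_x f x| <= c) ->
  (var_dist mu nu <= c%:E)%E.
Proof.
move=> h; apply: ge_ereal_sup => _ [f [mf f1] <-]; rewrite lee_fin.
have bf : f \in @bmeas _ X R by apply: bmeasP => //; exists 1.
exact: (h (BFun bf)).
Qed.

Theorem proposition4p1
  (R : realType) (d d' : measure_display)
  (X : measurableType d) (Omega : measurableType d')
  (P : R.-pker X ~> X)
  (Pr : X -> probability Omega R) (Phi : nat -> {mfun Omega >-> X})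
  (pi : probability X R) (A : set X) (kappa : R)
  (Xcg : countably_generated X)
  (Phi_chain : markov_chain P Pr Phi)
  (pi_invariant : invariant P pi)
  (pi_unique : forall mu : probability X R, invariant P mu ->
     forall B, measurable B -> mu B = pi B)
  (pi_irreducible : irreducible Pr Phi pi)
  (nstep_ac : forall (n : nat) (x : X), (1 <= n)%N ->
     nstep Pr Phi n x `<< pi)
  (P_reversible : reversible P pi)
  (A_atom : accessible_atom P pi A)
  (kappa_gt1 : 1 < kappa)
  (A_geom : (ereal_sup
     [set \int[Pr x]_w exp_base kappa (tau R Phi A w) | x in A] < +oo)%E) :
  let r := rho Pr Phi A kappa in
  [/\ (spectral_radius P pi <= (r^-1)%:E)%E,
      forall n : nat, (1 <= n)%N ->
        (ereal_sup [set var_dist (nstep Pr Phi n x) pi | x in A]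
          <= (Num.sqrt ((fine (pi A))^-1 - 1) * r ^- n)%:E)%E
    & {ae pi, forall x, exists C : R, forall n : nat,
        (var_dist (nstep Pr Phi n x) pi <= (C * r ^- n)%:E)%E}].
Proof.
move=> r; have [[mA [nu nuP]] piA_gt0] := A_atom.
have pi_A : 0 < fine (pi A) by rewrite fine_gt0// piA_gt0 (le_lt_trans (probability_le1 pi mA))// ltry.
have [x0 Ax0] : A !=set0.
  by apply/set0P; apply: contraTneq piA_gt0 => ->; rewrite measure0 ltxx.
have T_atom x : A x -> forall f : bfun X R, bavg P f x = bavg P f x0.
  move=> Ax f; rewrite /= /Rintegral; congr fine.
  by apply: eq_measure_integral => B mB _; rewrite !nuP.
have exp_ge0 t : (0 <= exp_base kappa t)%E.
  by case: t => [s| |] //=; rewrite ?leey// lee_fin powR_ge0.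
(* One point [x0] stands for the whole atom, since [T_atom] makes averages agree on it; from
   [A_geom] only finiteness at [x0] is kept. *)
pose I := (\int[Pr x0]_w exp_base kappa (tau R Phi A w))%E.
have I_fin : I \is a fin_num.
  rewrite ge0_fin_numE; last exact: integral_ge0.
  by apply: le_lt_trans A_geom; apply: ereal_sup_ubound; exists x0.
have moment N : \sum_(n < N) kappa ^+ n.+1 * fret P mA n x0 +
    kappa ^+ N.+1 * surv P mA N x0 <= fine I.
  by rewrite -lee_fin fineK//; exact: le_integral_exp_tau.
have T_irr B (mB : measurable B) : (0 < pi B)%E ->
    exists n, 0 < iter n (bavg P) (bindic R mB) x0.
  move=> /(pi_irreducible _ mB)/(_ x0)[n _ nB]; exists n.
  rewrite -(Rintegral_nstep Phi_chain) /Rintegral integral_indic// setIT.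
  by rewrite fine_gt0// nB (le_lt_trans (probability_le1 _ mB))// ltry.
have r_ge1 : 1 <= r by exact: (rho_ge1 Phi_chain mA kappa_gt1).
have r_gt0 : 0 < r by exact: lt_le_trans r_ge1.
have r_le : r <= kappa by exact: (rho_le Phi_chain mA kappa_gt1).
have even_lt1 z := @even_sum_lt1 _ _ _ _ _ _ _ _ Phi_chain _ mA _ kappa_gt1 x0 z Ax0.
have nstepE n x (f : bfun X R) :
    \int[nstep Pr Phi n x]_y f y - \int[pi]_y f y =
    iter n (bavg P) f x - bip pi f (bone X R).
  by rewrite (Rintegral_nstep Phi_chain) bip1.
split.
- apply: ge_ereal_sup => _ [->|[z zspec <-]].
    by rewrite lee_fin invr_ge0 ltW.
  rewrite lee_fin leNgt; apply/negP => rz; apply: zspec.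
  apply: (resolvent_set_gt pi_invariant _ _ rz); first by rewrite invr_ge0 ltW.
  move=> f; exact: (sip_norm_bavg_mean0 P_reversible Ax0 T_atom pi_A
    kappa_gt1 moment T_irr r_ge1 r_le even_lt1).
- move=> [//|n] _; apply: ge_ereal_sup => _ [x Ax <-].
  apply: var_dist_le => f f1; rewrite nstepE.
  rewrite iterS (T_atom _ Ax) -iterS.
  exact: (iter_avg_atom_le P_reversible Ax0 T_atom pi_A
    kappa_gt1 moment T_irr r_ge1 r_le even_lt1).
- apply: filterS2 (ae_moment P_reversible T_atom pi_A kappa_gt1 moment)
    (ae_cvg_surv Ax0 T_atom kappa_gt1 moment T_irr) => x [s' frets] survs.
  have [C CP] := iter_avg_le P_reversible Ax0 T_atom pi_A
    kappa_gt1 moment T_irr r_ge1 r_le even_lt1 frets survs.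
  exists C => n; apply: var_dist_le => f f1; rewrite nstepE.
  exact: CP.
Qed.
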